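(* The superharmonic space satisfies $$SH^B_n=\sum_{I\subseteq[n]}\mathbb C[\mathbf x_n]\odot d_{2I-1}(\delta^B_n),$$ i.e. $SH^B_n$ is the smallest $\mathbb C$-subspace of $\Omega_n$ containing $\delta^B_n$ and closed under $\partial_1,\dots,\partial_n$ and under $d_1,d_3,\dots,d_{2n-1}$.
   Context: $\mathbb C[\mathbf x_n]=\mathbb C[x_1,\dots,x_n]$; $\Omega_n=\mathbb C[\mathbf x_n]\otimes\wedge\{\theta_1,\dots,\theta_n\}$ with anticommuting $\theta_i$ commuting with the $x_j$. $\mathfrak B_n$ (signed permutations) acts on $\Omega_n$ by algebra automorphisms via $\pi(x_i)=x_{\pi(i)}$, $\pi(\theta_i)=\theta_{\pi(i)}$, $x_{-i}=-x_i$, $\theta_{-i}=-\theta_i$; $SI^B_n$ is the ideal of $\Omega_n$ generated by invariants with zero constant term. $\partial_i$ acts on $\Omega_n$ as $\partial/\partial x_i$ (θ's constant); $\partial^\theta_i$ acts on the exterior factor by $\theta_{j_1}\cdots\theta_{j_r}\mapsto(-1)^{s-1}\theta_{j_1}\cdots\widehat{\theta_{j_s}}\cdots\theta_{j_r}$ if $j_s=i$ and $\mapsto0$ if $i\notin\{j_1,\dots,j_r\}$. For $f,g\in\Omega_n$, $f\odot g=(\partial f)(g)$, where $\partial f$ is obtained from $f$ by substituting $x_i\mapsto\partial_i$, $\theta_i\mapsto\partial^\theta_i$. The superharmonic space is $SH^B_n=\{g\in\Omega_n: f\odot g=0\text{ for all }f\in SI^B_n\}$. For $j\ge1$, $d_j(f)=\sum_{i=1}^n\partial_i^j(f)\,\theta_i$;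 for $I=\{i_1<\dots<i_k\}\subseteq[n]$, $d_{2I-1}=d_{2i_1-1}\circ\cdots\circ d_{2i_k-1}$ (the identity if $I=\emptyset$). $\delta^B_n=\prod_{i=1}^nx_i\prod_{1\le i<j\le n}(x_i^2-x_j^2)$. $\mathbb C[\mathbf x_n]\odot g=\{f\odot g:f\in\mathbb C[\mathbf x_n]\}$. *)

(* Defs.v *)
From HB Require Import structures.
From mathcomp Require Import all_boot all_order all_algebra all_fingroup.
From mathcomp Require Import mpoly.
Set Implicit Arguments. Unset Strict Implicit. Unset Printing Implicit Defensive.
Import Order.TTheory GRing.Theory Num.Theory.
Local Open Scope ring_scope.

(* Superspace Omega_n over a coefficient field C:
   an element f is the finite sum  \sum_S (f S) * theta_S , where for
   S = {i1 < ... < ik} the basis monomial is theta_S = theta_i1 * ... * theta_ik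
   (increasing order) and f S : {mpoly C[n]}.  Indices are 0-based ('I_n). *)
Definition Omega (n : nat) (C : numClosedFieldType) :=
  {ffun {set 'I_n} -> {mpoly C[n]}}.

Definition pemb n (C : numClosedFieldType) (p : {mpoly C[n]}) : Omega n C :=
  [ffun S : {set 'I_n} => if S == set0 then p else 0].

Definition theta n (C : numClosedFieldType) (i : 'I_n) : Omega n C :=
  [ffun S : {set 'I_n} => if S == [set i] then 1 else 0].

(* sign of theta_S theta_T = sgnST S T * theta_(S u T) for disjoint S, T *)
Definition sgnST n (C : numClosedFieldType) (S T : {set 'I_n}) : {mpoly C[n]} :=
  (-1) ^+ #|[set p in setX S T | (p.2 < p.1)%N]|.

(* product in Omega_n (x's commute with everything, theta's anticommute) *)
Definition omul n (C : numClosedFieldType) (f g : Omega n C) : Omega n C :=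
  [ffun U : {set 'I_n} => \sum_(S : {set 'I_n} | S \subset U)
               sgnST C S (U :\: S) * f S * g (U :\: S)].

Definition oprod n (C : numClosedFieldType) (l : seq (Omega n C)) : Omega n C := foldr (@omul n C) (pemb 1) l.

(* signed permutations: pi = (sigma, eps), pi(i) = (-1)^(eps i) sigma(i) *)
Definition signedPerm n := ({perm 'I_n} * {ffun 'I_n -> bool})%type.

Definition sgn_of n (C : numClosedFieldType) (pi : signedPerm n) (i : 'I_n) : C := (-1) ^+ pi.2 i.

(* action of pi as the algebra automorphism with
   x_i |-> x_(pi i) = eps_i x_(sigma i),  theta_i |-> theta_(pi i) = eps_i theta_(sigma i) *)
Definition act n (C : numClosedFieldType) (pi : signedPerm n) (f : Omega n C) : Omega n C :=
  \sum_(S : {set 'I_n})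
    omul (pemb (f S \mPo [tuple sgn_of C pi i *: 'X_(pi.1 i) | i < n]))
         (oprod [seq sgn_of C pi i *: theta C (pi.1 i) | i <- enum S]).

Definition invariant n (C : numClosedFieldType) (f : Omega n C) := forall pi : signedPerm n, act pi f = f.

Definition const_term n (C : numClosedFieldType) (f : Omega n C) : C := (f set0)@_0.

Definition inSI n (C : numClosedFieldType) (f : Omega n C) : Prop :=
  exists (m : nat) (a g b : 'I_m -> Omega n C),
    (forall k, invariant (g k) /\ const_term (g k) = 0) /\
    f = \sum_(k < m) omul (omul (a k) (g k)) (b k).

Definition xDm n (C : numClosedFieldType) (m : 'X_{1..n}) (f : Omega n C) : Omega n C :=
  [ffun S : {set 'I_n} => mderivm m (f S)].

Definition xD n (C : numClosedFieldType) (i : 'I_n) (f : Omega n C) : Omega n C :=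
  [ffun S : {set 'I_n} => mderiv i (f S)].

(* theta-derivative partial^theta_i :
   theta_j1..theta_jr |-> (-1)^(s-1) theta_j1..^theta_js..theta_jr if j_s = i, 0 otherwise;
   on the basis, (partial^theta_i f)_T = (-1)^#{j in T | j < i} f_(T u {i}) if i notin T. *)
Definition thetaD n (C : numClosedFieldType) (i : 'I_n) (f : Omega n C) : Omega n C :=
  [ffun T : {set 'I_n} => if i \in T then 0
             else (-1) ^+ #|[set j in T | (j < i)%N]| * f (i |: T)].

(* f ⊙ g = (partial f)(g), with x_i |-> partial_i and theta_i |-> partial^theta_i *)
Definition odot n (C : numClosedFieldType) (f g : Omega n C) : Omega n C :=
  \sum_(S : {set 'I_n})
    \sum_(m <- msupp (f S))
       (f S)@_m *: xDm m (foldr (@thetaD n C) g (enum S)).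

Definition SH n (C : numClosedFieldType) (g : Omega n C) : Prop :=
  forall f : Omega n C, inSI f -> odot f g = 0.

Definition dop n (C : numClosedFieldType) (j : nat) (f : Omega n C) : Omega n C :=
  \sum_(i < n) omul (iter j (xD i) f) (theta C i).

(* d_{2I-1} = d_{2 i1 - 1} o ... o d_{2 ik - 1}  (1-based i's; with 0-based i : 'I_n,
   2(i+1)-1 = 2i+1) *)
Definition dI n (C : numClosedFieldType) (I : {set 'I_n}) (f : Omega n C) : Omega n C :=
  foldr (fun (i : 'I_n) g => dop (2 * i + 1)%N g) f (enum I).

Definition deltaB n (C : numClosedFieldType) : Omega n C :=
  pemb (\prod_(i < n) 'X_i *
        \prod_(i < n) \prod_(j < n | (i < j)%N) ('X_i ^+ 2 - 'X_j ^+ 2)).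

(* Main.v *)
Require Import Defs.
From HB Require Import structures.
From mathcomp Require Import all_boot all_order all_algebra all_fingroup.
From mathcomp Require Import mpoly.
From mathcomp Require Import ssrcomplements ring zify.
Set Implicit Arguments. Unset Strict Implicit. Unset Printing Implicit Defensive.
Import Order.TTheory GRing.Theory Num.Theory.
Local Open Scope ring_scope.

(** Write [y_i = x_i^2], let [e_k] be the elementary symmetric polynomials in the
    [y_i], and let a polynomial act on polynomials by substituting partial
    derivatives.  A superharmonic form has coefficients in the space [M] killed
    by all [e_k], and it is killed by the contractions
    [sum_i ∂_i^(2j-1) ∂^θ_i].

    Commutative algebra.  For a set [J] of indices put
    [f_s = x_s prod_(i < s) (y_i - y_s)] and
    [g_(J,s) = x_s prod_(i > s, i notin J) (y_i - y_s)].  Modulo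
    [e_1, ..., e_(m-1)] and the [g_(J,r)], [r \in J], where [m = n - #|J|], one has
    [f_s g_(J,s) = c e_m] with [c != 0] for every [s < min J].  So a regular sequence
    stays regular when [e_m] is replaced by its factor [g_(J,s)].  Working in the
    dual modules (inverse systems), where regularity is surjectivity and
    permuting a regular sequence only uses local nilpotency, this gives by
    induction on [J] that the elements of [M] killed by all [g_(J,s)], [s \in J],
    are the [prod_(s in J) f_s] (∂)-images of [M].  Descending from [J = [n]],
    where only constants are left, it also gives [M = C[∂] delta].

    Superspace.  If all coefficients of a superharmonic form below [S] (for the
    weight [sum_(i in S) i]) vanish, contracting with the odd polynomial
    [t prod_(i > s, i notin S) (y_i - t^2)] shows that its coefficient at [S] is
    killed by [g_(S,s)], so it is a derivative of [prod_(s in S) f_s] (∂) delta, and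
    that is the leading coefficient of a combination of the [d_(2I-1) delta]
    obtained from the odd polynomials [t prod_(i < s) (y_i - t^2)].  Subtract and
    iterate.  Conversely, commuting an invariant past [d_j] ([j] odd) produces
    another invariant without constant term, which reduces the inclusion to an
    invariant polynomial [p] acting on [delta]: the exponents of the monomials of
    [p(∂) delta] would be odd and pairwise distinct, which is impossible in degree
    less than [n^2]. *)

(** * Polynomial differential operators with constant coefficients *)

Definition dd n (R : comNzRingType) (a v : {mpoly R[n]}) : {mpoly R[n]} :=
  \sum_(m <- msupp a) a@_m *: mderivm m v.

Section DiffOp.
Context (n : nat) (R : comNzRingType).
Implicit Types (a b v w p : {mpoly R[n]}) (m k : 'X_{1..n}).

(** The index type depends only on a bound for the size of [a], so operators with different supports
    can be added term by term. *)
Lemma ddE d a v : (msize a <= d)%N ->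
  dd a v = \sum_(m : 'X_{1..n < d}) a@_m *: mderivm m v.
Proof.
move=> le_ad; pose P (m : 'X_{1..n < d}) := val m \in msupp a.
rewrite (bigID P) {}/P /= addrC big1 ?add0r; last first.
  by move=> m /memN_msupp_eq0 ->; rewrite scale0r.
rewrite /dd (big_mksub 'X_{1..n < d}) //=; first exact/msupp_uniq.
by move=> m /msize_mdeg_lt /leq_trans; apply.
Qed.

Lemma dd_is_linear a : linear (dd a).
Proof.
move=> c v w; rewrite /dd scaler_sumr -big_split /=; apply: eq_bigr => m _.
by rewrite mderivmD mderivmZ scalerDr !scalerA mulrC.
Qed.

HB.instance Definition _ a :=
  GRing.isLinear.Build R {mpoly R[n]} {mpoly R[n]} _ (dd a) (dd_is_linear a).

Lemma ddDl a b v : dd (a + b) v = dd a v + dd b v.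
Proof.
set d := maxn (msize (a + b)) (maxn (msize a) (msize b)).
rewrite !(@ddE d) ?leq_max ?leqnn ?orbT // -big_split /=.
by apply: eq_bigr => m _; rewrite mcoeffD scalerDl.
Qed.

Lemma ddZl c a v : dd (c *: a) v = c *: dd a v.
Proof.
set d := maxn (msize (c *: a)) (msize a).
rewrite !(@ddE d) ?leq_max ?leqnn ?orbT // scaler_sumr /=.
by apply: eq_bigr => m _; rewrite mcoeffZ scalerA.
Qed.

Lemma dd0l v : dd 0 v = 0. Proof. by rewrite /dd msupp0 big_nil. Qed.
Lemma ddNl a v : dd (- a) v = - dd a v.
Proof. by rewrite -scaleN1r ddZl scaleN1r. Qed.
Lemma ddBl a b v : dd (a - b) v = dd a v - dd b v.
Proof. by rewrite ddDl ddNl. Qed.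

Lemma dd_suml I (r : seq I) (P : pred I) (F : I -> {mpoly R[n]}) v :
  dd (\sum_(i <- r | P i) F i) v = \sum_(i <- r | P i) dd (F i) v.
Proof.
by apply: (big_morph (fun a => dd a v)) => [a b|]; rewrite ?ddDl ?dd0l.
Qed.

Lemma ddX m v : dd 'X_[m] v = mderivm m v.
Proof. by rewrite /dd msuppX big_seq1 mcoeffX eqxx scale1r. Qed.

Lemma ddC c v : dd c%:MP v = c *: v.
Proof. by rewrite -[c%:MP]mulr1 mul_mpolyC ddZl -mpolyX0 ddX mderivm0m. Qed.

Lemma dd1 v : dd 1 v = v.
Proof. by rewrite -mpolyC1 ddC scale1r. Qed.

Lemma ddM a b v : dd (a * b) v = dd a (dd b v).
Proof.
rewrite [in LHS](mpolyE a) mulr_suml dd_suml [RHS]/dd.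
apply: eq_bigr => m _; rewrite -scalerAl ddZl; congr (_ *: _).
rewrite [in LHS](mpolyE b) mulr_sumr dd_suml [dd b v]/dd raddf_sum /=.
apply: eq_bigr => k _; rewrite -scalerAr ddZl -mpolyXD ddX mderivmZ.
by rewrite addmC mderivmDm.
Qed.

Lemma dd_comm a b v : dd a (dd b v) = dd b (dd a v).
Proof. by rewrite -!ddM mulrC. Qed.

Lemma mcoeff_dd a v k d : (msize a <= d)%N ->
  (dd a v)@_k = \sum_(m : 'X_{1..n < d})
    a@_m * (v@_(m + k) *+ \prod_(i < n) ((m + k)%MM i) ^_ (m i)).
Proof.
move=> le_ad; rewrite (ddE _ le_ad) raddf_sum; apply: eq_bigr => m _ /=.
by rewrite mcoeffZ mcoeff_mderivm.
Qed.

Lemma msupp_dd a v k : k \in msupp (dd a v) ->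
  exists m, [/\ a@_m != 0 & (m + k)%MM \in msupp v].
Proof.
rewrite mcoeff_msupp (mcoeff_dd _ _ (leqnn (msize a))) => nz.
have [m|all0] := pickP [pred m : 'X_{1..n < msize a} |
    a@_m * (v@_(m + k) *+ \prod_(i < n) ((m + k)%MM i) ^_ (m i)) != 0].
  move=> /= nzm; exists (val m); split.
    by apply: contraNneq nzm => ->; rewrite mul0r.
  by rewrite mcoeff_msupp; apply: contraNneq nzm => ->; rewrite mul0rn mulr0.
by case/negP: nz; rewrite big1 // => m _; have /negbFE/eqP := all0 m.
Qed.

(** Without constant term every monomial of [a] differentiates at least once. This is the source of
    the local nilpotency in [dd_nilp]. *)
Lemma msize_dd_lt a v : a@_0 = 0 -> v != 0 -> (msize (dd a v) < msize v)%N.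
Proof.
move=> a0 nzv; have [->|nz] := eqVneq (dd a v) 0.
  by rewrite msize0 lt0n msize_poly_eq0.
rewrite -(mlead_deg nz); have /msupp_dd[m [nzm /msize_mdeg_lt]] := mlead_supp nz.
apply: leq_trans; rewrite mdegD ltnS -add1n leq_add2r lt0n mdeg_eq0.
by apply: contraNneq nzm => ->; rewrite a0.
Qed.

Lemma dd_nilp a v N : a@_0 = 0 -> (msize v <= N)%N -> dd (a ^+ N) v = 0.
Proof.
move=> a0; elim: N v => [|N IHN] v le_vN.
  by move: le_vN; rewrite leqn0 msize_poly_eq0 => /eqP ->; rewrite raddf0.
have [->|nzv] := eqVneq v 0; first by rewrite raddf0.
rewrite exprSr ddM IHN // -ltnS; exact: leq_trans (msize_dd_lt a0 nzv) le_vN.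
Qed.

End DiffOp.

(** * Regular sequences of operators *)

Section Regular.
Context (n : nat) (R : comNzRingType).
Implicit Types (a b f g v w : {mpoly R[n]}) (L l : seq {mpoly R[n]}).

Definition ann L v := forall a, a \in L -> dd a v = 0.

Definition ddsurj (P : {mpoly R[n]} -> Prop) a :=
  forall v, P v -> exists2 u, P u & dd a u = v.

(* Dual of regularity: [a] acts injectively on the quotient of the polynomial
   ring by the ideal (L) iff a(∂) is surjective on the inverse system of (L). *)
Fixpoint regular L l :=
  if l is a :: l' then ddsurj (ann L) a /\ regular (a :: L) l' else True.

Lemma annS L1 L2 : {subset L1 <= L2} -> forall v, ann L2 v -> ann L1 v.
Proof. by move=> s12 v H a /s12; apply: H. Qed.

Lemma eq_ann L1 L2 : L1 =i L2 -> forall v, ann L1 v <-> ann L2 v.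
Proof. by move=> e v; split; apply: annS => a; rewrite e. Qed.

Lemma ann_cons a L v : ann (a :: L) v <-> dd a v = 0 /\ ann L v.
Proof.
split=> [H|[H0 H] b]; last by rewrite inE => /predU1P[->|/H].
by split=> [|b Lb]; apply: H; rewrite inE ?eqxx // Lb orbT.
Qed.

Lemma ann0 L : ann L 0. Proof. by move=> a _; rewrite raddf0. Qed.
Lemma annD L v w : ann L v -> ann L w -> ann L (v + w).
Proof. by move=> Hv Hw a La; rewrite raddfD /= Hv // Hw // addr0. Qed.
Lemma annN L v : ann L v -> ann L (- v).
Proof. by move=> Hv a La; rewrite raddfN /= Hv // oppr0. Qed.
Lemma annB L v w : ann L v -> ann L w -> ann L (v - w).
Proof. by move=> Hv Hw; apply/annD/annN. Qed.
Lemma ann_dd L b v : ann L v -> ann L (dd b v).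
Proof. by move=> Hv a La; rewrite dd_comm Hv // raddf0. Qed.

Lemma ddsurj_ext (P Q : {mpoly R[n]} -> Prop) a b :
  (forall v, P v <-> Q v) -> (forall v, P v -> dd a v = dd b v) ->
  ddsurj P a -> ddsurj Q b.
Proof.
move=> PQ eab H v /PQ /H[u Pu <-]; exists u; first exact/PQ.
by rewrite eab.
Qed.

Lemma regular_ext L1 L2 l : (forall v, ann L1 v <-> ann L2 v) ->
  regular L1 l -> regular L2 l.
Proof.
elim: l L1 L2 => //= a l IHl L1 L2 e12 [Ha Hl]; split.
  exact: ddsurj_ext Ha.
by apply: IHl Hl => v; rewrite !ann_cons e12.
Qed.

Lemma regular_cat L l1 l2 :
  regular L (l1 ++ l2) <-> regular L l1 /\ regular (rev l1 ++ L) l2.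
Proof.
elim: l1 L => [|a l1 IH] L /=; first by split=> // -[].
by rewrite IH rev_cons cat_rcons; split=> [[? []]|[[]]].
Qed.

(** Since a(∂) lowers the size, b u = v is solved by induction on the size of [v]: write a v = b u0
    by induction, lift u0 = a u', and correct the difference v - b u', which [a] kills, by
    surjectivity of [b] on the kernel of [a]. *)
Lemma regular_swap L a b l : a@_0 = 0 ->
  regular L (a :: b :: l) -> regular L (b :: a :: l).
Proof.
move=> a0 /= [Ha [Hb Hl]]; split; last split.
- move=> v; have := leqnn (msize v); move: {2}(msize v) => N.
  elim: N v => [|N IHN] v le_vN Lv.
    move: le_vN; rewrite leqn0 msize_poly_eq0 => /eqP ->.
    by exists 0; rewrite ?raddf0 //; apply: ann0.
  have [->|nzv] := eqVneq v 0; first by exists 0; rewrite ?raddf0 //; apply: ann0.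
  have [||u Lu Eu] := IHN (dd a v); last 1 first.
  + have [u' Lu' Eu'] := Ha _ Lu.
    have [|u'' /ann_cons[_ Lu''] Eu''] := Hb (v - dd b u').
      apply/ann_cons; split; last by apply/annB => //; apply: ann_dd.
      by rewrite raddfB /= dd_comm Eu' Eu subrr.
    exists (u' + u''); first exact: annD.
    by rewrite raddfD /= Eu'' addrC subrK.
  + by rewrite -ltnS; apply: leq_trans (msize_dd_lt a0 nzv) le_vN.
  + exact: ann_dd.
(* An [a]-preimage of [v] is corrected by an element of the kernel of [a] with the same image under
   [b]. *)
- move=> v /ann_cons[bv Lv]; have [u Lu Eu] := Ha v Lv.
  have [|u'' /ann_cons[au'' Lu''] Eu''] := Hb (dd b u).
    by apply/ann_cons; split; [rewrite dd_comm Eu | apply: ann_dd].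
  exists (u - u''); last by rewrite raddfB /= au'' subr0.
  by apply/ann_cons; split; [rewrite raddfB /= Eu'' subrr | apply: annB].
- by apply: regular_ext Hl; apply: eq_ann => x; rewrite !inE orbCA.
Qed.

Lemma regular_perm L l1 l2 : (forall a, a \in l1 -> a@_0 = 0) ->
  perm_eq l1 l2 -> regular L l1 -> regular L l2.
Proof.
(* One element is pulled to the front by successive swaps with those before it. *)
have front L' l a l' : (forall b, b \in l -> b@_0 = 0) ->
    regular L' (l ++ a :: l') -> regular L' (a :: l ++ l').
  elim: l L' => // c l IH L' H0 /= [Hc /IH Hl]; apply: (@regular_swap _ c).
    by apply: H0; rewrite mem_head.
  by split=> //; apply: Hl => b lb; apply: H0; rewrite inE lb orbT.
elim: l2 L l1 => [|a l2 IH] L l1 H0 p12; first by rewrite (perm_nilP p12).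
have l1a : a \in l1 by rewrite (perm_mem p12) mem_head.
case/splitPr: l1a p12 H0 => r1 r2 p12 H0 /front[].
  by move=> b r1b; apply: H0; rewrite mem_cat r1b.
split=> //; apply: IH b => [c|].
  by rewrite mem_cat => H; apply: H0; rewrite mem_cat inE orbCA H orbT.
rewrite -(perm_cons a); apply: perm_trans p12.
exact: (permEl (perm_catCA [:: a] r1 r2)).
Qed.

End Regular.

(** * Elementary symmetric polynomials in the squares of a subset of the variables *)

Section Symmetric.
Context (n : nat) (C : numFieldType).
Implicit Types (v : {mpoly C[n]}) (T U : {set 'I_n}) (m : 'X_{1..n}).

Lemma ddXn_eq0_lt (i : 'I_n) d v m :
  dd ('X_i ^+ d) v = 0 -> m \in msupp v -> (m i < d)%N.
Proof.
rewrite mpolyXn ddX => dv0 vm; rewrite ltnNge; apply/negP => le_dm.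
have le_m : (U_(i) *+ d <= m)%MM.
  apply/mnm_lepP => j; rewrite mulmnE mnm1E; case: eqP => [<-|_] //.
  by rewrite mul1n.
have := mcoeff_mderivm (U_(i) *+ d) v (m - U_(i) *+ d)%MM.
rewrite dv0 mcoeff0 addmC submK // => /esym/eqP; rewrite mulrn_eq0.
move: vm; rewrite mcoeff_msupp => /negPf ->; rewrite orbF => /eqP pr0.
have : (0 < \prod_(j < n) (m j) ^_ ((U_(i) *+ d)%MM j))%N.
  by apply: prodn_gt0 => j; rewrite ffact_gt0; exact/mnm_lepP.
by rewrite pr0.
Qed.

(** Integrate each monomial in x_i: this divides by positive integers and leaves the exponents of
    the other variables unchanged. *)
Lemma dd_primitive (i : 'I_n) v : exists2 u, dd 'X_i u = v &
  forall (j : 'I_n) d, j != i -> dd ('X_j ^+ d) v = 0 -> dd ('X_j ^+ d) u = 0.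
Proof.
exists (\sum_(m <- msupp v) (v@_m / (m i).+1%:R) *: 'X_[m + U_(i)]).
  rewrite [RHS]mpolyE raddf_sum /=; apply: eq_bigr => m _.
  rewrite linearZ /= ddX mderivmU1m mderivX addmK mnmDE mnm1E eqxx addn1.
  by rewrite scalerA divfK // pnatr_eq0.
move=> j d ji dv0; rewrite raddf_sum big_seq big1 //= => m vm.
rewrite linearZ /= mpolyXn ddX mderivnX mnmDE mnm1E eq_sym (negPf ji) addn0.
by rewrite ffact_small ?scale0r ?scaler0 //; exact: ddXn_eq0_lt vm.
Qed.

Definition charT T : {poly {mpoly C[n]}} := \prod_(i in T) ('X - ('X_i ^+ 2)%:P).

(** For k at most #|T| this is (-1)^k times the k-th elementary symmetric polynomial in the x_i^2, i
    in T. For larger k the truncated subtraction returns the constant coefficient. *)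
Definition eT T k : {mpoly C[n]} := (charT T)`_(#|T| - k).

Definition es T k : seq {mpoly C[n]} := [seq eT T j | j <- iota 1 k].

Lemma charT_D1 T i : i \in T ->
  charT T = charT (T :\ i) * ('X - ('X_i ^+ 2)%:P).
Proof. by move=> Ti; rewrite /charT (big_setD1 i) //= mulrC. Qed.

Lemma charT_monic T : charT T \is monic.
Proof. by apply: monic_prod => i _; apply: monicXsubC. Qed.

Lemma size_charT T : size (charT T) = #|T|.+1.
Proof.
by rewrite /charT -big_enum size_prod_XsubC -cardE.
Qed.

Lemma eT_D1 T i k : i \in T -> (k < #|T|)%N ->
  eT T k = eT (T :\ i) k - 'X_i ^+ 2 * (charT (T :\ i))`_(#|T| - k).
Proof.
move=> Ti lt_k; rewrite /eT {1}(charT_D1 Ti) mulrBr coefB coefMX coefMC.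
have cT : #|T| = #|T :\ i|.+1 by rewrite (cardsD1 i T) Ti.
by rewrite cT ltnS in lt_k *; rewrite subSn //= [X in _ - X]mulrC.
Qed.

Lemma eT_full T : eT T #|T| = \prod_(i in T) - 'X_i ^+ 2.
Proof.
rewrite /eT subnn -horner_coef0 /charT horner_prod; apply: eq_bigr => i _.
by rewrite hornerXsubC sub0r.
Qed.

Lemma mcoeff0_Xn (i : 'I_n) d : (0 < d)%N -> ('X_i ^+ d : {mpoly C[n]})@_0 = 0.
Proof.
move=> d0; rewrite mcoeffXn -mdeg_eq0 mdegMn mdeg1 mul1n.
by rewrite gtn_eqF.
Qed.

(** On a space killed by [c], operators congruent modulo [c] agree. *)
Lemma regular_mod L (I : eqType) (s : seq I) (F G : I -> {mpoly C[n]}) c :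
  c \in L -> (forall k, k \in s -> exists d, F k = G k + c * d) ->
  regular L (map G s) -> regular L (map F s).
Proof.
elim: s L => //= k s IHs L Lc FG [HF Hs].
have eFG v : ann L v -> dd (G k) v = dd (F k) v.
  have [d ->] := FG k (mem_head _ _).
  by move=> Hv; rewrite ddDl ddM dd_comm (Hv c Lc) raddf0 addr0.
split; first by apply: ddsurj_ext HF.
apply: (@regular_ext _ _ (G k :: L)).
  by move=> v; rewrite !ann_cons; split=> -[H1 H2]; move: H1; rewrite eFG.
apply: IHs => // [|j sj]; first by rewrite inE Lc orbT.
by apply: FG; rewrite inE sj orbT.
Qed.

Lemma ddsurjM (P : {mpoly C[n]} -> Prop) (a b : {mpoly C[n]}) :
  ddsurj P a -> ddsurj P b -> ddsurj P (a * b).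
Proof. by move=> Ha Hb v /Ha[u /Hb[w Pw <-] <-]; exists w; rewrite ?ddM. Qed.

Lemma ddsurjMl L (a b : {mpoly C[n]}) : ddsurj (ann L) (a * b) -> ddsurj (ann L) a.
Proof.
by move=> H v /H[u Lu <-]; exists (dd b u); rewrite ?ddM //; apply: ann_dd.
Qed.

Lemma ddsurjMr L (a b : {mpoly C[n]}) : ddsurj (ann L) (a * b) -> ddsurj (ann L) b.
Proof. by rewrite mulrC; apply: ddsurjMl. Qed.

Lemma mcoeff0_eT T k : (0 < k <= #|T|)%N -> (eT T k)@_0 = 0.
Proof.
elim: {T}#|T| {-2}T (erefl #|T|) k => [|t IH] T cT k.
  by rewrite cT leqn0; case: k.
case/andP=> k0; rewrite cT leq_eqVlt ltnS => /orP[/eqP ->|le_kt].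
  have [i Ti] : exists i, i \in T by apply/card_gt0P; rewrite cT.
  rewrite -cT eT_full (bigD1 i) //= mulNr mcoeffN rmorphM /= mcoeff0_Xn //.
  by rewrite mul0r oppr0.
have [i Ti] : exists i, i \in T by apply/card_gt0P; rewrite cT.
rewrite (eT_D1 Ti) ?cT // mcoeffB rmorphM /= mcoeff0_Xn // mul0r subr0 IH //.
  by move: cT; rewrite (cardsD1 i) Ti add1n => -[].
by rewrite k0; move: cT; rewrite (cardsD1 i) Ti add1n => -[->].
Qed.

(** Induction on #|T|, where [U] collects the variables whose squares are already divided out. The
    top polynomial is a product of negated squares, so it suffices that each single square can stand
    in its place. *)
Lemma regular_es U T : [disjoint U & T] ->
  regular [seq 'X_i ^+ 2 | i in U] (es T #|T|).
Proof.
move: {2}#|T| (erefl #|T|) => t; elim: t T U => [|t IH] T U cT dUT.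
  by rewrite cT.
have cT1 i : i \in T -> #|T :\ i| = t.
  by move=> Ti; move: cT; rewrite (cardsD1 i) Ti add1n => -[].
(* With x_i^2 moved to the front, surjectivity is integration in x_i done twice, and modulo x_i^2
   the other polynomials become those of [T :\ i]. *)
have key i : i \in T ->
    regular [seq 'X_i ^+ 2 | i in U] (rcons (es T t) ('X_i ^+ 2)).
  move=> Ti; apply: (@regular_perm _ _ _ ('X_i ^+ 2 :: es T t)).
  - move=> a; rewrite inE => /predU1P[->|/mapP[k]]; first exact: mcoeff0_Xn.
    rewrite mem_iota add1n ltnS => /andP[k0 le_kt] ->.
    by rewrite mcoeff0_eT // k0 cT leqW.
  - by rewrite perm_sym perm_rcons.
  have iU : i \notin U by apply: contraL Ti => /(disjointFr dUT) ->.
  split.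
    have surj1 : forall v, ann [seq 'X_i ^+ 2 | i in U] v ->
        exists2 u, ann [seq 'X_i ^+ 2 | i in U] u & dd 'X_i u = v.
      move=> v Hv; have [u Eu Hu] := dd_primitive i v; exists u => //.
      move=> _ /imageP[j Uj ->]; apply: Hu; last exact/Hv/image_f.
      by apply: contraNneq iU => <-.
    by rewrite expr2; apply: ddsurjM.
  apply: (@regular_ext _ _ [seq 'X_i ^+ 2 | i in i |: U]).
    apply: eq_ann => a; apply/imageP/idP => [[j]|].
      rewrite !inE => /predU1P[->|Uj] ->; first by rewrite eqxx.
      by apply/orP; right; apply: image_f.
    rewrite inE => /predU1P[->|/imageP[j Uj ->]].
      by exists i; rewrite ?setU11.
    by exists j; rewrite // !inE Uj orbT.
  apply: (@regular_mod _ _ _ _ (eT (T :\ i)) ('X_i ^+ 2)).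
  - by apply: image_f; rewrite setU11.
  - move=> k; rewrite mem_iota add1n ltnS => /andP[k0 le_kt].
    exists (- (charT (T :\ i))`_(#|T| - k)).
    by rewrite (eT_D1 Ti) ?cT // mulrN.
  rewrite -/(es _ _) -(cT1 i Ti); apply: IH; first exact: cT1.
  rewrite -setI_eq0; apply/eqP/setP => j; rewrite !inE.
  have [->|ji] := eqVneq j i; rewrite //=.
  by apply/negbTE/negP => /andP[/(disjointFr dUT) ->].
have -> : es T #|T| = rcons (es T t) (eT T #|T|).
  by rewrite cT /es -(addn1 t) iotaD map_cat cats1 add1n addn1.
rewrite -cats1; apply/regular_cat.
have [i0 Ti0] : exists i, i \in T by apply/card_gt0P; rewrite cT.
split; first by move: (key _ Ti0); rewrite -cats1 => /regular_cat[].
split=> //; rewrite eT_full; elim/big_ind: _.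
- by move=> v Hv; exists v; rewrite ?dd1.
- exact: ddsurjM.
- move=> i /key; rewrite -cats1 => /regular_cat[_ [H _]] v /annN/H[u Hu Eu].
  by exists u; rewrite // ddNl Eu opprK.
Qed.

End Symmetric.

(** * The complete intersections attached to subsets of the variables *)

Section Elimination.
Context (n : nat) (C : numFieldType).
Implicit Types (J : {set 'I_n}) (r s i : 'I_n).

Definition fF s : {mpoly C[n]} :=
  'X_s * \prod_(i < n | (i < s)%N) ('X_i ^+ 2 - 'X_s ^+ 2).

Definition gF J s : {mpoly C[n]} :=
  'X_s * \prod_(i < n | (s < i)%N && (i \notin J)) ('X_i ^+ 2 - 'X_s ^+ 2).

Section Ideal.
(** An arbitrary ideal, instantiated later by the polynomials whose operators kill a given [v]. *)
Variable Id : {mpoly C[n]} -> Prop.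
Hypothesis Id0 : Id 0.
Hypothesis IdD : forall a b, Id a -> Id b -> Id (a + b).
Hypothesis IdM : forall a b, Id b -> Id (a * b).

Let IdN a : Id a -> Id (- a).
Proof. by move=> Ha; rewrite -mulN1r; apply: IdM. Qed.

Let IdB a b : Id a -> Id b -> Id (a - b).
Proof. by move=> Ha Hb; apply/IdD/IdN. Qed.

Let Id_sum (I : Type) (l : seq I) (P : pred I) (F : I -> {mpoly C[n]}) :
  (forall x, P x -> Id (F x)) -> Id (\sum_(x <- l | P x) F x).
Proof. by move=> H; elim/big_ind: _. Qed.

(** Since q is monic of degree k, coefficient l + k of G q is G_l plus multiples of higher
    coefficients of G. By downward induction on l, a congruence of G q with a polynomial of degree
    at most k makes G constant. *)
Lemma monic_cancel_mod (G q Z : {poly {mpoly C[n]}}) k :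
    q \is monic -> size q = k.+1 ->
    (forall l, Id (G * q - Z)`_l) -> (forall l, (k < l)%N -> Id Z`_l) ->
  (forall l, (0 < l)%N -> Id G`_l) /\ Id (G`_0 - Z`_k).
Proof.
move=> monq szq HGZ HZ.
have qk : q`_k = 1 by move/monicP: monq; rewrite lead_coefE szq.
have coefGq l : (forall l', (l < l')%N -> Id G`_l') ->
    Id ((G * q)`_(l + k) - G`_l).
  move=> Hl; rewrite coefM (bigD1 (inord l)) //= inordK ?ltnS ?leq_addr //.
  rewrite addKn qk mulr1 addrAC subrr add0r; apply: Id_sum => -[j ltj] /=.
  rewrite -val_eqE /= inordK ?ltnS ?leq_addr // => neq_jl.
  case: (ltngtP j l) neq_jl => // [ltjl _|ltlj _].
    rewrite [X in _ * X]nth_default ?mulr0 // szq; lia.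
  by rewrite mulrC; apply/IdM/Hl.
have HG l : (0 < l)%N -> Id G`_l.
  have [d] := ubnP (size G - l); elim: d l => // d IH l ltd l0.
  case: (leqP (size G) l) => [?|ltl]; first by rewrite nth_default.
  have -> : G`_l = (G * q - Z)`_(l + k) + Z`_(l + k) - ((G * q)`_(l + k) - G`_l).
    by rewrite coefB; ring.
  apply: IdB; first by apply: IdD; [exact: HGZ | apply: HZ; lia].
  by apply: coefGq => l' ltl'; apply: IH; lia.
split=> //.
have -> : G`_0 - Z`_k = (G * q - Z)`_k - ((G * q)`_(0 + k) - G`_0).
  by rewrite coefB add0n; ring.
by apply: IdB; [exact: HGZ | apply: coefGq => l'; apply: HG].
Qed.

Lemma horner_mod_const (G : {poly {mpoly C[n]}}) a :
  (forall l, (0 < l)%N -> Id G`_l) -> Id (G.[a] - G`_0).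
Proof.
move=> HG; rewrite (horner_coef_wide _ (leqnSn (size G))).
rewrite big_ord_recl expr0 mulr1 addrAC subrr add0r.
by apply: Id_sum => i _; rewrite mulrC; apply/IdM/HG.
Qed.

Lemma deriv_charT J :
  (charT C J)^`() = \sum_(r in J) charT C (J :\ r).
Proof.
have [m] := ubnP #|J|; elim: m J => // m IH J ltJ.
have [->|[r Jr]] := set_0Vmem J.
  by rewrite /charT !big_set0 -polyC1 derivC.
have ltJr : (#|J :\ r| < m)%N by move: ltJ; rewrite (cardsD1 r) Jr.
rewrite (charT_D1 _ Jr) derivM derivXsubC mulr1 (IH _ ltJr) (big_setD1 r Jr) /=.
rewrite addrC; congr (_ + _); rewrite mulr_suml; apply: eq_bigr => i.
rewrite !inE => /andP[ir Ji]; rewrite [in RHS](@charT_D1 _ _ _ r).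
  by congr (charT C _ * _); apply/setP => j; rewrite !inE andbCA.
by rewrite !inE eq_sym ir.
Qed.

(** As s < min J, the indices in the products of [fF s] and [gF J s] are together all i outside J
    other than s, so up to sign f g is y_s P0(y_s). Modulo the ideal, Z = X p' - n p has degree at
    most #|J|, with coefficient -m e_m there, where e_m is [eT C setT m]. Its quotient G by q is
    therefore congruent to that constant, while G(y_s) = y_s P0(y_s). *)
Lemma fg_mod_eT J s :
    (forall r, r \in J -> (s < r)%N) -> (forall r, r \in J -> Id (gF J r)) ->
    (forall k, (0 < k < #|~: J|)%N -> Id (eT C setT k)) ->
  Id (fF s * gF J s - ((-1) ^+ #|~: J| * #|~: J|%:R) * eT C setT #|~: J|).
Proof.
move=> ltsJ HgJ He; set m := #|~: J|; set y := fun i : 'I_n => 'X_i ^+ 2 : {mpoly C[n]}.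
have sJ : s \in ~: J by rewrite inE; apply/negP => /ltsJ; rewrite ltnn.
pose P0 := charT C (~: J :\ s); pose PJ := charT C (~: J); pose q := charT C J.
pose p := charT C [set: 'I_n].
have PJE : PJ = P0 * ('X - (y s)%:P) by apply: charT_D1.
have pE : p = PJ * q.
  rewrite /p /PJ /q /charT [in LHS](bigID (mem J)) /= mulrC; congr (_ * _).
    by apply: eq_bigl => i; rewrite !inE.
  by apply: eq_bigl => i; rewrite !inE.
have cardJ : (#|J| + m)%N = n by rewrite /m cardsC card_ord.
(* The factors with i > r make up the product in [gF J r] up to sign; s is not among them because s
   < r. *)
have Hr r : r \in J -> Id (y r * P0.[y r]).
  move=> Jr; rewrite /P0 /charT horner_prod.
  rewrite (eq_bigr (fun i => y r - y i)); last by move=> i _; rewrite hornerXsubC.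
  rewrite (bigID (fun i : 'I_n => (r < i)%N)) /=.
  set A := \prod_(i in _ | _) _; set B := \prod_(i in _ | _) _.
  have -> : A = (-1) ^+ #|[pred i : 'I_n | (r < i)%N && (i \notin J)]| *
      \prod_(i < n | (r < i)%N && (i \notin J)) (y i - y r).
    rewrite -prodrN; apply: eq_big => [i|i _]; last by rewrite opprB.
    rewrite !inE andbC; have [ltri|//] := ltnP; rewrite /=.
    by case: eqP => // e; move: (ltsJ r Jr); rewrite -e; lia.
  rewrite {1}/y expr2.
  set S := (-1) ^+ _; set D := \prod_(i < n | _) _.
  rewrite (_ : _ * _ = ('X_r * S * B) * gF J r); last by rewrite /gF -/(y r) -/D; ring.
  exact/IdM/HgJ.
have exC r : exists Cr, 'X * P0 - (y r * P0.[y r])%:P = Cr * ('X - (y r)%:P).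
  by apply/factor_theorem; rewrite rootE !hornerE subrr.
have [Cr HC] : exists Cr : 'I_n -> {poly {mpoly C[n]}}, forall r,
    'X * P0 - (y r * P0.[y r])%:P = Cr r * ('X - (y r)%:P).
  by exists (fun r => sval (sig_eqW (exC r))) => r; case: sig_eqW.
(* [G] is the quotient of [Z] by [q] modulo the ideal: X P0 / (X - y_r) is replaced by its
   polynomial part [Cr r], and the remainder y_r P0(y_r) lies in the ideal by [Hr]. *)
pose G := 'X * PJ^`() + \sum_(r in J) ('X - (y s)%:P) * Cr r - PJ *+ n.
pose Z := 'X * p^`() - p *+ n.
have GZ : G * q - Z = - \sum_(r in J)
    (('X - (y s)%:P) * charT C (J :\ r)) * (y r * P0.[y r])%:P.
  have -> : G * q - Z =
      \sum_(r in J) ('X - (y s)%:P) * Cr r * q - 'X * PJ * q^`().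
    rewrite /G /Z pE derivM -mulr_suml.
    rewrite -[PJ *+ n]mulr_natr -[(PJ * q) *+ n]mulr_natr.
    have ring1 (R : comNzRingType) (x a a' b b' c k : R) :
        (x * a' + c - a * k) * b - (x * (a' * b + a * b') - a * b * k) =
        c * b - x * a * b' by ring.
    exact: ring1.
  rewrite deriv_charT mulr_sumr -sumrB -sumrN; apply: eq_bigr => r Jr.
  have -> : (y r * P0.[y r])%:P = 'X * P0 - Cr r * ('X - (y r)%:P).
    by rewrite -HC opprB addrC subrK.
  have ring2 (R : comNzRingType) (x a b c d e : R) :
    a * c * (d * b) - x * (e * a) * d = - (a * d * (x * e - c * b)) by ring.
  by rewrite /q (charT_D1 _ Jr) PJE ring2.
have szp : size p = n.+1 by rewrite size_charT cardsT card_ord.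
(* The factor n - l removes the leading coefficient 1 of [p]; the other coefficients are symmetric
   polynomials of positive degree. *)
have Zl l : Z`_l = - (p`_l *+ (n - l)).
  rewrite /Z coefB coefMn coefXM; case: l => [|l] /=; first by rewrite sub0r subn0.
  rewrite coef_deriv; case: (leqP l.+1 n) => [le_ln|lt_nl].
    by rewrite mulrnBr // opprB.
  by rewrite nth_default ?szp // !mul0rn subrr oppr0.
have [||HG HG0] := @monic_cancel_mod G q Z #|J| (charT_monic _ _) (size_charT _ _).
- move=> l; rewrite GZ coefN coef_sum; apply/IdN/Id_sum => r Jr.
  by rewrite coefMC; apply/IdM/Hr.
- move=> l ltl; rewrite Zl; apply: IdN; case: (ltngtP l n) => [ltln|ltnl|->].
  + rewrite -mulr_natl; apply: IdM.
    have -> : p`_l = eT C setT (n - l).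
      by rewrite /eT cardsT card_ord subKn // ltnW.
    by apply: He; rewrite -/m; lia.
  + by rewrite nth_default ?szp // mul0rn.
  + by rewrite subnn.
have Gs : G.[y s] = y s * P0.[y s].
  have PJ0 : PJ.[y s] = 0 by rewrite PJE !hornerE subrr mulr0.
  rewrite /G hornerD hornerN hornerMn PJ0 mul0rn subr0 hornerD horner_sum.
  rewrite [X in _ + X]big1 => [|r _]; last by rewrite !hornerE subrr mul0r.
  by rewrite addr0 PJE derivM derivXsubC !hornerE subrr mulr0 add0r.
have fgE : fF s * gF J s = (-1) ^+ m.-1 * (y s * P0.[y s]).
  rewrite /fF /gF /P0 /charT horner_prod.
  have -> : \prod_(i in ~: J :\ s) ('X - ('X_i ^+ 2)%:P).[y s] =
      (-1) ^+ m.-1 * \prod_(i in ~: J :\ s) (y i - y s).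
    have -> : m.-1 = #|~: J :\ s| by rewrite /m (cardsD1 s) sJ.
    by rewrite -prodrN; apply: eq_bigr => i _; rewrite hornerXsubC opprB.
  have sgK z : (-1) ^+ m.-1 * (y s * ((-1) ^+ m.-1 * z)) = y s * z.
    by rewrite mulrCA [X in _ * X]mulrA -expr2 sqrr_sign mul1r.
  rewrite sgK.
  rewrite [in RHS](bigID (fun i : 'I_n => (i < s)%N)) /=.
  rewrite [X in _ = _ * (X * _)](eq_bigl
      (fun i : 'I_n => (i < s)%N)) => [|i]; last first.
    rewrite !inE -val_eqE /=; case: ltngtP => //= lt_is; rewrite ?andbF //.
    by rewrite andbT; apply/negP => /ltsJ; lia.
  rewrite [X in _ = _ * (_ * X)](eq_bigl
      (fun i : 'I_n => (s < i)%N && (i \notin J))) => [|i]; last first.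
    by rewrite !inE -val_eqE /=; case: ltngtP => //=; rewrite ?andbF ?andbT.
  by rewrite /y; ring.
have Zk : Z`_#|J| = - (m%:R * eT C setT m).
  have -> : Z`_#|J| = - (p`_#|J| *+ m) by rewrite Zl (_ : (n - #|J|)%N = m) // -[X in (X - _)%N]cardJ addKn.
  rewrite mulr_natl; congr (- (_ *+ _)).
  by rewrite /eT cardsT card_ord -[X in (X - _)%N]cardJ addnK.
have m0 : (0 < m)%N by rewrite /m (cardsD1 s) sJ.
have -> : fF s * gF J s - (-1) ^+ m * m%:R * eT C setT m =
    (-1) ^+ m.-1 * (G.[y s] - Z`_#|J|).
  by rewrite fgE Gs Zk -{2}(prednK m0) exprS; ring.
apply: IdM; have -> : G.[y s] - Z`_#|J| = (G.[y s] - G`_0) + (G`_0 - Z`_#|J|).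
  by ring.
by apply: IdD => //; apply: horner_mod_const.
Qed.

End Ideal.
End Elimination.

(** * Exchanging the top symmetric polynomial for one of its factors, by induction on J *)

Section Chain.
Context (n : nat) (C : numFieldType).
Implicit Types (J : {set 'I_n}) (r s i : 'I_n) (u v w : {mpoly C[n]}).

Definition gens J : seq {mpoly C[n]} :=
  es C setT #|~: J| ++ [seq gF C J r | r in J].

(** [gens J] without its top symmetric polynomial e_m, the one that is exchanged for a factor. *)
Definition gens1 J : seq {mpoly C[n]} :=
  es C setT #|~: J|.-1 ++ [seq gF C J r | r in J].

Lemma esS (T : {set 'I_n}) k : es C T k.+1 = rcons (es C T k) (eT C T k.+1).
Proof. by rewrite /es -{1}(addn1 k) iotaD map_cat cats1 add1n. Qed.

(** The only factor that could be lost is i = s, and it occurs only when r < s. *)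
Lemma gF_setU1 J s r : (s <= r)%N -> gF C (s |: J) r = gF C J r.
Proof.
move=> le_sr; congr (_ * _); apply: eq_bigl => i; rewrite !inE.
by case: eqP => [->|] //; rewrite ltnNge le_sr.
Qed.

Section Step.
Variables (J : {set 'I_n}) (s : 'I_n).
Hypothesis ltsJ : forall r, r \in J -> (s < r)%N.
Let m := #|~: J|.

Let sJ : s \notin J.
Proof. by apply/negP => /ltsJ; rewrite ltnn. Qed.

Let m_gt0 : (0 < m)%N.
Proof. by rewrite /m (cardsD1 s) inE sJ. Qed.

Let cardJs : #|~: (s |: J)| = m.-1.
Proof.
rewrite /m (cardsD1 s (~: J)) inE sJ add1n /=; apply: eq_card => i.
by rewrite !inE negb_or.
Qed.

Lemma ann_gens v : ann (gens J) v <-> ann (gens1 J) v /\ dd (eT C setT m) v = 0.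
Proof.
rewrite (eq_ann (L2 := eT C setT m :: gens1 J)) ?ann_cons; first tauto.
move=> a; rewrite /gens /gens1 -/m -{1}(prednK m_gt0) esS prednK //.
by rewrite mem_cat mem_rcons !inE mem_cat orbA.
Qed.

Lemma perm_gF_setU1 : perm_eq [seq gF C (s |: J) r | r in s |: J]
  (gF C J s :: [seq gF C J r | r in J]).
Proof.
have p : perm_eq (enum (s |: J)) (s :: enum J).
  apply: uniq_perm; rewrite /= ?enum_uniq ?mem_enum ?sJ // => i.
  by rewrite inE !mem_enum !inE.
apply: perm_trans (perm_map _ p) _; rewrite /= gF_setU1 // perm_cons.
rewrite (_ : map _ _ = [seq gF C J r | r in J]) //; apply/eq_in_map => r.
by rewrite mem_enum => /ltsJ/ltnW; apply: gF_setU1.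
Qed.

Lemma ann_gens_setU1 v :
  ann (gens (s |: J)) v <-> ann (gens1 J) v /\ dd (gF C J s) v = 0.
Proof.
rewrite /gens cardJs -/(gens1 _) (eq_ann (L2 := gF C J s :: gens1 J)).
  by rewrite ann_cons; tauto.
move=> a; rewrite mem_cat (perm_mem perm_gF_setU1) !inE mem_cat.
by rewrite orbCA.
Qed.

Lemma dd_fg v : ann (gens1 J) v ->
  dd (fF C s * gF C J s) v = ((-1) ^+ m * m%:R) *: dd (eT C setT m) v.
Proof.
move=> Hv; apply/eqP; rewrite -subr_eq0 -ddZl -ddBl -mul_mpolyC; apply/eqP.
rewrite mpolyCM mpolyC_nat rmorphXn rmorphN1.
apply: (@fg_mod_eT n C (fun a => dd a v = 0)) => [|a b||//|r Jr|k /andP[k0 ltkm]].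
- exact: dd0l.
- by rewrite ddDl => -> ->; rewrite addr0.
- by move=> a b; rewrite ddM => ->; rewrite raddf0.
- by apply: Hv; rewrite mem_cat image_f ?orbT.
- apply: Hv; rewrite mem_cat map_f // mem_iota k0 add1n ltnS.
  by rewrite -ltnS prednK.
Qed.

Let c_neq0 : (-1) ^+ m * m%:R != 0 :> C.
Proof. by rewrite mulf_neq0 ?signr_eq0 // pnatr_eq0 -lt0n. Qed.

Lemma dd_fg_eq0 v : ann (gens1 J) v ->
  dd (fF C s * gF C J s) v = 0 <-> ann (gens J) v.
Proof.
move=> Hv; rewrite ann_gens dd_fg //; split=> [/eqP|[_ ->]]; last first.
  by rewrite scaler0.
by rewrite scaler_eq0 (negPf c_neq0) => /eqP ->.
Qed.

Lemma mcoeff0_gens K a : a \in gens K -> a@_0 = 0.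
Proof.
rewrite mem_cat => /orP[/mapP[k]|/imageP[r Kr ->]].
  rewrite mem_iota add1n ltnS => /andP[k0 lek] ->; apply: mcoeff0_eT.
  by rewrite k0 (leq_trans lek) // cardsT max_card.
by rewrite /gF -['X_r]expr1 rmorphM /= mcoeff0_Xn // mul0r.
Qed.

Hypothesis reg : regular [::] (gens J).

Let ann_rev L v : ann (rev L ++ [::]) v <-> ann L v.
Proof. by apply: eq_ann => a; rewrite cats0 mem_rev. Qed.

(** With e_m moved to the end of the regular sequence, it is surjective on the inverse system of
    [gens1 J], where f g acts as a nonzero multiple of it. *)
Lemma regular_gens1 :
  regular [::] (gens1 J) /\ ddsurj (ann (gens1 J)) (fF C s * gF C J s).
Proof.
have : regular [::] (rcons (gens1 J) (eT C setT m)).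
  apply: regular_perm reg; first exact: mcoeff0_gens.
  rewrite /gens /gens1 -/m -{1}(prednK m_gt0) esS prednK //.
  by rewrite rcons_cat -!cats1 -catA perm_cat2l perm_catC.
rewrite -cats1 => /regular_cat[r1 [r2 _]]; split=> //.
move=> v Hv; case: (r2 (((-1) ^+ m * m%:R)^-1 *: v)).
  by apply/ann_rev => a La; rewrite linearZ /= Hv ?scaler0.
move=> u /ann_rev Hu Eu; exists u; rewrite // dd_fg // Eu.
by rewrite scalerA divff ?scale1r.
Qed.

Lemma regular_gens_setU1 : regular [::] (gens (s |: J)).
Proof.
have [r1 r2] := regular_gens1.
apply: (@regular_perm _ _ _ (rcons (gens1 J) (gF C J s))).
- move=> a; rewrite mem_rcons inE => /predU1P[->|].
    by rewrite /gF -['X_s]expr1 rmorphM /= mcoeff0_Xn // mul0r.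
  move=> Ja; apply: (@mcoeff0_gens (s |: J)); move: Ja; rewrite !mem_cat.
  rewrite cardJs (perm_mem perm_gF_setU1) inE => /orP[-> //|->].
  by rewrite !orbT.
- rewrite perm_sym /gens cardJs /gens1 -/m rcons_cat perm_cat2l.
  by rewrite (permPl perm_gF_setU1) perm_sym perm_rcons.
rewrite -cats1; apply/regular_cat; split=> //; split=> // v /ann_rev Hv.
have [u Hu Eu] := ddsurjMr r2 Hv; exists u => //; exact/ann_rev.
Qed.

(** By surjectivity of f on the inverse system of [gens1 J], write v = f u there; then g v = 0 says
    f g u = 0, that is, u is killed by [gens J]. *)
Lemma ann_gens_fF v :
  ann (gens (s |: J)) v <-> exists2 u, ann (gens J) u & v = dd (fF C s) u.
Proof.
have [_ r2] := regular_gens1; rewrite ann_gens_setU1; split.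
  case=> Hv gv; have [u Hu Eu] := ddsurjMl r2 Hv; exists u => //.
  by apply/dd_fg_eq0 => //; rewrite mulrC ddM Eu.
case=> u Hu ->; have [Hu1 _] := (ann_gens u).1 Hu.
split; first exact: ann_dd.
by rewrite -ddM mulrC; apply/dd_fg_eq0.
Qed.

(** The same exchange with f and g interchanged: u = g w, and f u = 0 becomes f g w = 0. *)
Lemma ker_fF u : ann (gens J) u -> dd (fF C s) u = 0 ->
  exists2 w, ann (gens J) w & u = dd (gF C J s) w.
Proof.
have [_ r2] := regular_gens1 => Hu fu.
have [Hu1 _] := (ann_gens u).1 Hu.
have [w Hw Ew] := ddsurjMr r2 Hu1; exists w => //.
by apply/dd_fg_eq0 => //; rewrite ddM Ew.
Qed.

End Step.

(** Sets are built by adding a new minimum. This suits both the condition s < min J of the exchange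
    step and the folds over [enum] in superspace. *)
Lemma set_min_ind (P : {set 'I_n} -> Prop) :
    P set0 -> (forall J s, (forall r, r \in J -> (s < r)%N) -> P J -> P (s |: J)) ->
  forall J, P J.
Proof.
move=> P0 PU J; have [k] := ubnP #|J|; elim: k J => // k IH J ltJ.
have [->//|[s0 Js0]] := set_0Vmem J.
case: (arg_minnP (fun i : 'I_n => val i) Js0) => s Js min_s; have {}Js : s \in J by [].
rewrite -(setD1K Js); apply: PU => [r|].
  rewrite !inE => /andP[rs /min_s le_sr]; rewrite ltn_neqAle le_sr andbT.
  by rewrite eq_sym.
by apply: IH; move: ltJ; rewrite (cardsD1 s J) Js.
Qed.

Lemma regular_gens J : regular [::] (gens J).
Proof.
elim/set_min_ind: J => [|J s ltsJ]; last exact: regular_gens_setU1.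
rewrite /gens (_ : image _ _ = [::]); last by rewrite /image_mem enum_set0.
rewrite cats0 setC0; have := @regular_es n C set0 setT.
rewrite /image_mem enum_set0 /=; apply.
by rewrite disjoints_subset sub0set.
Qed.

Lemma ann_gens_prod J v : ann (gens J) v <->
  exists2 u, ann (gens set0) u & v = dd (\prod_(s in J) fF C s) u.
Proof.
elim/set_min_ind: J v => [|J s ltsJ IH] v.
  rewrite big_set0; split=> [Hv|[u Hu ->]]; last by rewrite dd1.
  by exists v; rewrite ?dd1.
rewrite (ann_gens_fF ltsJ (regular_gens J)).
have sJ : s \notin J by apply/negP => /ltsJ; rewrite ltnn.
split=> [[u /IH[w Hw ->] ->]|[u Hu ->]].
  by exists w; rewrite // -ddM big_setU1.
exists (dd (\prod_(s in J) fF C s) u); last by rewrite -ddM big_setU1.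
by apply/IH; exists u.
Qed.

End Chain.

(** * Cyclic generators of the inverse systems *)

Section Cyclic.
Context (n : nat) (C : numFieldType) (delta : {mpoly C[n]}).
Implicit Types (J : {set 'I_n}) (s i : 'I_n) (u v w : {mpoly C[n]}).

Lemma gens0 : gens C (set0 : {set 'I_n}) = es C setT n.
Proof.
rewrite /gens (_ : image _ _ = [::]); last by rewrite /image_mem enum_set0.
by rewrite cats0 setC0 cardsT card_ord.
Qed.

(** x_i^2 is a root of [charT], so x_i^(2n) lies in the ideal of the symmetric polynomials and every
    exponent in [v] is below 2n. *)
Lemma msize_ann_es v : ann (es C setT n) v -> (msize v <= (2 * n) * n + 1)%N.
Proof.
move=> Hv; have yn i : dd ('X_i ^+ (2 * n)) v = 0.
  have := @horner_coef _ (charT C [set: 'I_n]) ('X_i ^+ 2).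
  rewrite size_charT cardsT card_ord big_ord_recr /=.
  have -> : (charT C [set: 'I_n])`_n = 1.
    have /monicP := charT_monic C [set: 'I_n].
    by rewrite lead_coefE size_charT cardsT card_ord.
  rewrite (charT_D1 _ (in_setT i)) hornerM hornerXsubC subrr mulr0 mul1r.
  rewrite -exprM => /eqP; rewrite eq_sym addrC addr_eq0 => /eqP ->.
  rewrite ddNl dd_suml big1 ?oppr0 // => j _.
  rewrite mulrC ddM (_ : dd _`_j v = 0) ?raddf0 //; apply: Hv.
  apply/mapP; exists (n - j)%N; last by rewrite /eT -charT_D1 ?inE // cardsT card_ord subKn // ltnW.
  by rewrite mem_iota add1n ltnS leq_subr subn_gt0 ltn_ord.
rewrite msizeE; apply/bigmax_leqP_seq => m vm _; rewrite addn1 ltnS mdegE.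
apply: leq_trans (leq_sum _ _ : _ <= \sum_(i < n) 2 * n)%N _ => [i _|].
  by apply/ltnW/(ddXn_eq0_lt (yn i)).
by rewrite sum_nat_const card_ord mulnC.
Qed.

(** For J = [n] the product in [gF] is empty, so the generators include every variable. *)
Lemma ann_gensT v : ann (gens C [set: 'I_n]) v -> v = (v@_0)%:MP.
Proof.
move=> Hv; apply: msize1_polyC; rewrite msizeE; apply/bigmax_leqP_seq => m vm _.
rewrite ltnS leqn0 mdeg_eq0; apply/eqP/mnmP => i; rewrite mnm0E.
apply/eqP; rewrite -leqn0 -ltnS; apply: ddXn_eq0_lt vm; rewrite expr1.
have -> : 'X_i = gF C setT i.
  by rewrite /gF big1 ?mulr1 // => j; rewrite inE andbF.
by apply: Hv; rewrite mem_cat image_f ?orbT ?inE.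
Qed.

Hypothesis ann_delta : ann (es C setT n) delta.
Hypothesis delta_neq0 : dd (\prod_s fF C s) delta != 0.

Let cyc J := forall v, ann (gens C J) v ->
  exists a, v = dd a (dd (\prod_(s in J) fF C s) delta).

Lemma cyclicT : cyc setT.
Proof.
move=> v /ann_gensT Ev.
have H : ann (gens C setT) (dd (\prod_(s in [set: 'I_n]) fF C s) delta).
  by apply/ann_gens_prod; exists delta; rewrite ?gens0.
have E : \prod_(s in [set: 'I_n]) fF C s = \prod_s fF C s.
  by apply: eq_bigl => s; rewrite inE.
move: H delta_neq0; rewrite E; move: (dd _ _) => w /ann_gensT Ew.
rewrite Ew mpolyC_eq0 => w0; exists (v@_0 / w@_0)%:MP.
by rewrite ddC [LHS]Ev -mul_mpolyC -mpolyCM divfK.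
Qed.

(** A Nakayama argument. Cyclicity at [s |: J] gives f u = b f w, so u - b w is in the kernel of f
    and equals g u' by [ker_fF]. Iterating pushes the error into the image of g^N, which is zero
    once N reaches the uniform size bound. *)
Lemma cyclic_step J s : (forall r, r \in J -> (s < r)%N) -> cyc (s |: J) -> cyc J.
Proof.
move=> ltsJ cycs v Hv; set w := dd _ delta.
have sJ : s \notin J by apply/negP => /ltsJ; rewrite ltnn.
have Hw : ann (gens C J) w by apply/ann_gens_prod; exists delta; rewrite ?gens0.
have bound u : ann (gens C J) u -> (msize u <= (2 * n) * n + 1)%N.
  case/ann_gens_prod => u'; rewrite gens0 => Hu' ->; apply: msize_ann_es.
  exact: ann_dd.
have step N : exists a u, ann (gens C J) u /\ v = dd a w + dd (gF C J s ^+ N) u.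
  elim: N => [|N [a [u [Hu ->]]]].
    by exists 0, v; rewrite dd0l add0r dd1.
  have : ann (gens C (s |: J)) (dd (fF C s) u).
    by apply/(ann_gens_fF ltsJ (regular_gens C J)); exists u.
  case/cycs => b; rewrite big_setU1 //= [dd (_ * _) delta]ddM -/w [dd b _]dd_comm => Eb.
  have [||u' Hu' Eu'] := @ker_fF _ C J s ltsJ (regular_gens C J) (u - dd b w).
  - by apply: annB => //; apply: ann_dd.
  - by rewrite raddfB /= Eb subrr.
  exists (a + gF C J s ^+ N * b), u'; split=> //.
  rewrite exprSr ddM -Eu' raddfB /= ddDl ddM.
  by rewrite -[RHS]addrA; congr (_ + _); rewrite [RHS]addrC subrK.
have [a [u [Hu ->]]] := step ((2 * n) * n + 1)%N; exists a.
rewrite dd_nilp ?addr0 //; last exact: bound.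
by rewrite /gF -['X_s]expr1 rmorphM /= mcoeff0_Xn // mul0r.
Qed.

Lemma cyclic0 v : ann (es C setT n) v -> exists a, v = dd a delta.
Proof.
(* The final segments of the indices lead from [n] down to the empty set, removing the minimum each
   time. *)
have H k : (k <= n)%N -> cyc [set i : 'I_n | (k <= i)%N].
  elim: k => [|k IH] le_kn.
    by rewrite (_ : [set _ | _] = setT); [exact: cyclicT | apply/setP => i; rewrite !inE].
  apply: (@cyclic_step _ (Ordinal le_kn)) => [r|]; first by rewrite inE.
  rewrite (_ : _ |: _ = [set i : 'I_n | (k <= i)%N]); first exact/IH/ltnW.
  by apply/setP => i; rewrite !inE -val_eqE /= eq_sym [RHS]leq_eqVlt.
have := H n (leqnn n) v; rewrite (_ : [set _ | _] = set0).
  by rewrite gens0 big_set0 dd1.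
by apply/setP => i; rewrite !inE leqNgt ltn_ord.
Qed.

Lemma cyclic J : cyc J.
Proof.
move=> v /ann_gens_prod[u]; rewrite gens0 => /cyclic0[a ->] ->.
by exists a; rewrite dd_comm.
Qed.

Lemma ann_gF J h : ann (es C setT n) h ->
    (forall s, s \in J -> dd (gF C J s) h = 0) ->
  exists a, h = dd a (dd (\prod_(s in J) fF C s) delta).
Proof.
move=> Hh gh; apply: cyclic => a; rewrite mem_cat => /orP[/mapP[k]|].
  rewrite mem_iota => /andP[k0 ltk] ->; apply: Hh; apply: map_f.
  rewrite mem_iota k0 (leq_trans ltk) // leq_add2l.
  by rewrite (leq_trans (max_card _)) ?card_ord.
by case/imageP => s Js ->; apply: gh.
Qed.

End Cyclic.

(** * The type B Vandermonde polynomial *)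

(** The extremal case is 0, 1, ..., k - 1. The induction is on a strict bound N + 1 for the entries:
    N is removed if present, and the remaining distinct entries below N number at most N. *)
Lemma sum_uniq_geq (s : seq nat) : uniq s ->
  (size s * (size s).-1 <= 2 * \sum_(x <- s) x)%N.
Proof.
have [N] : exists N, all (fun x => x < N)%N s.
  exists (\max_(x <- s) x).+1; apply/allP => x sx; rewrite ltnS.
  exact: leq_bigmax_seq.
elim: N s => [|N IH] s lts us.
  by case: s lts {us} => // _; rewrite big_nil.
case sN : (N \in s); last first.
  apply: IH => //; apply/allP => x sx; have := allP lts x sx.
  by rewrite ltnS leq_eqVlt; case: eqP sN => // <-; rewrite sx.
rewrite (big_rem _ sN) /=; have urs := rem_uniq N us.
have lt_rem : all (fun x => x < N)%N (rem N s).
  apply/allP => x; rewrite (mem_rem_uniq _ us) inE => /andP[xN sx].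
  by have := allP lts x sx; rewrite ltnS leq_eqVlt (negPf xN).
have := IH _ lt_rem urs; rewrite size_rem //.
have : (size (rem N s) <= size (iota 0 N))%N.
  apply: uniq_leq_size => // x /(allP lt_rem) ltx.
  by rewrite mem_iota.
rewrite size_iota size_rem //; case: (size s) => [|[|k]] /=; nia.
Qed.

Section Delta.
Context (n : nat) (C : numClosedFieldType).
Implicit Types (p v : {mpoly C[n]}) (i j : 'I_n) (m k : 'X_{1..n}).

Definition delta : {mpoly C[n]} := \prod_(i < n) 'X_i *
  \prod_(i < n) \prod_(j < n | (i < j)%N) ('X_i ^+ 2 - 'X_j ^+ 2).

Definition spsubst (pi : signedPerm n) p :=
  p \mPo [tuple sgn_of C pi i *: 'X_(pi.1 i) | i < n].

Definition flip i : signedPerm n := (1%g, [ffun j => j == i]).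
Definition unsigned (s : 'S_n) : signedPerm n := (s, [ffun => false]).

Lemma prod_fF : \prod_s fF C s = delta.
Proof.
rewrite /delta big_split /=; congr (_ * _).
by rewrite (exchange_big_dep predT).
Qed.

Lemma delta_neq0 : delta != 0.
Proof.
rewrite mulf_neq0 //; apply/prodf_neq0 => i _.
  by rewrite -msize_poly_eq0 msizeX.
apply/prodf_neq0 => j lt_ij; rewrite subr_eq0.
apply/eqP => /(congr1 (mcoeff (U_(i) *+ 2))); rewrite !mcoeffXn eqxx.
case: eqP => [/mnmP/(_ i)|_ /eqP]; last by rewrite oner_eq0.
by rewrite !mulmnE !mnm1E eqxx; case: eqP lt_ij => // ->; rewrite ltnn.
Qed.

(** The constant coefficient is the sum of the squared coefficients of [delta], each weighted by a
    product of factorials. The coefficients are integers, so their squares are nonnegative in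
    [C]. *)
Lemma dd_delta_neq0 : dd delta delta != 0.
Proof.
have [d Ed] : exists d : {mpoly int[n]}, delta = map_mpoly intr d.
  exists (\prod_(i < n) 'X_i *
    \prod_(i < n) \prod_(j < n | (i < j)%N) ('X_i ^+ 2 - 'X_j ^+ 2)).
  rewrite rmorphM !rmorph_prod; congr (_ * _); apply: eq_bigr => i _ /=.
    by rewrite map_mpolyX.
  rewrite rmorph_prod; apply: eq_bigr => j _ /=.
  by rewrite rmorphB !rmorphXn /= !map_mpolyX.
have sq_ge0 m : 0 <= delta@_m * delta@_m.
  by rewrite Ed mcoeff_map_mpoly -rmorphM /= ler0z -expr2 sqr_ge0.
have := delta_neq0; rewrite -msupp_eq0; case Es: (msupp delta) => [//|m0 l] _.
have m0s : m0 \in msupp delta by rewrite Es mem_head.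
apply/eqP => /(congr1 (mcoeff 0)); apply/eqP.
rewrite mcoeff0 (mcoeff_dd _ _ (leqnn _)) psumr_neq0; last first.
  by move=> m _; rewrite addm0 mulrnAr mulrn_wge0.
apply/hasP; exists (BMultinom (msize_mdeg_lt m0s)); rewrite ?mem_index_enum //=.
rewrite addm0 mulrnAr pmulrn_lgt0; last by apply: prodn_gt0 => i; rewrite ffact_gt0.
by rewrite lt_def sq_ge0 andbT mulf_neq0 // -mcoeff_msupp.
Qed.

Lemma tnth_spsubst pi i : 'X_i \mPo [tuple sgn_of C pi i *: 'X_(pi.1 i) | i < n] = sgn_of C pi i *: 'X_(pi.1 i) :> {mpoly C[n]}.
Proof. by rewrite comp_mpolyXU -tnth_nth tnth_mktuple. Qed.

Lemma spsubst_unsigned s p : spsubst (unsigned s) p = msym s p.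
Proof.
rewrite /spsubst /comp_mpoly /msym /mmap; apply: eq_bigr => m _.
congr (_ * _); apply: mmap1_eq => i.
by rewrite tnth_mktuple /sgn_of ffunE expr0 scale1r.
Qed.

Lemma mcoeff_flip i p m : (spsubst (flip i) p)@_m = (-1) ^+ m i * p@_m.
Proof.
rewrite [in RHS](mpolyE p) /spsubst comp_mpolyEX !raddf_sum mulr_sumr /=.
apply: eq_bigr => k _; rewrite !mcoeffZ comp_mpolyX mulrCA; congr (_ * _).
have -> : \prod_(j < n) tnth [tuple sgn_of C (flip i) j *: 'X_((flip i).1 j) | j < n] j ^+ k j
    = (-1) ^+ k i *: 'X_[k].
  rewrite [in RHS]mpolyXE_id; under eq_bigr => j _.
    rewrite tnth_mktuple /sgn_of /= perm1 ffunE exprZn; over.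
  rewrite scaler_prod (bigD1 i) //= eqxx expr1 big1 ?mulr1 // => j.
  by move=> /negPf ->; rewrite expr0 expr1n.
rewrite mcoeffZ mcoeffX; case: eqP => [->//|_]; by rewrite !mulr0.
Qed.

Lemma flip_delta i : spsubst (flip i) delta = - delta.
Proof.
rewrite /spsubst /delta rmorphM /= mulrC -mulNr [RHS]mulrC; congr (_ * _).
  rewrite rmorph_prod; apply: eq_bigr => j _; rewrite rmorph_prod.
  apply: eq_bigr => l _; rewrite rmorphB !rmorphXn /= !tnth_spsubst /= !perm1.
  by rewrite !exprZn !sqrr_sign !scale1r.
rewrite rmorph_prod /= (bigD1 i) //= tnth_spsubst /= perm1.
rewrite [in RHS](bigD1 i) //= -mulNr; congr (_ * _).
  by rewrite /sgn_of ffunE eqxx scaleN1r.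
apply: eq_bigr => j /negPf ji; rewrite tnth_spsubst /= perm1 /sgn_of ffunE ji.
by rewrite scale1r.
Qed.

Lemma msym_delta i j : i != j -> msym (tperm i j) delta = - delta.
Proof.
move=> neq_ij; set t := tperm i j.
(* The nodes are negated because the Vandermonde determinant has factors a_j - a_i for i < j; a
   transposition then swaps two columns. *)
have -> : delta = \prod_(l < n) 'X_l * \det (Vandermonde n (\row_l - 'X_l ^+ 2)).
  rewrite det_Vandermonde; congr (_ * _); apply: eq_bigr => l _.
  by apply: eq_bigr => l' _; rewrite !mxE opprK addrC.
rewrite rmorphM /= -mulrN; congr (_ * _).
  rewrite rmorph_prod [RHS](reindex_inj (@perm_inj _ t)) /=.
  by apply: eq_bigr => l _; rewrite /msym mmapX mmap1U.
rewrite -det_map_mx; set V := Vandermonde n _.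
have -> : map_mx (msym t) V = col_perm t V.
  apply/matrixP => a b; rewrite !mxE rmorphXn rmorphN rmorphXn /=.
  by rewrite /msym mmapX mmap1U.
by rewrite col_permE det_mulmx det_perm odd_permV odd_tperm neq_ij expr1 mulrN1.
Qed.

Lemma msym_mderivm s m v :
  msym s (mderivm m v) = mderivm [multinom m ((s^-1)%g i) | i < n] (msym s v).
Proof.
apply/mpolyP => k; rewrite mcoeff_sym !mcoeff_mderivm mcoeff_sym.
set m' := [multinom m _ | _ < n].
have -> : [multinom (m' + k)%MM (s i) | i < n] =
    (m + [multinom k (s i) | i < n])%MM.
  by apply/mnmP => i; rewrite !mnmE permK.
congr (_ *+ _); rewrite [RHS](reindex_inj (@perm_inj _ s)) /=.
by apply: eq_bigr => i _; rewrite !mnmE permK.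
Qed.

Lemma msym_dd s p v : msym s (dd p v) = dd (msym s p) (msym s v).
Proof.
rewrite {1}/dd [in RHS](mpolyE p) raddf_sum [msym s (\sum_(_ <- _) _)]raddf_sum dd_suml /=.
apply: eq_bigr => m _; rewrite !msymZ ddZl; congr (_ *: _).
by rewrite msymX ddX msym_mderivm.
Qed.

Lemma dhomog_delta : delta \is (n * n)%N.-homog.
Proof.
have homX i : ('X_i : {mpoly C[n]}) \is 1.-homog by rewrite dhomogX /= mdeg1.
have homp (I : Type) (r : seq I) (P : pred I) (d : I -> nat) (F : I -> {mpoly C[n]}) :
    (forall x, P x -> F x \is (d x).-homog) ->
    \prod_(x <- r | P x) F x \is (\sum_(x <- r | P x) d x)%N.-homog.
  move=> H; elim/big_rec2: _ => [|x e q Px hq]; first exact: dhomog1.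
  by apply: dhomogM => //; apply: H.
(* The degree is counted along the factorization into the [fF C s], of degree 1 + 2s. *)
have -> : (n * n = \sum_(s < n) (1 + \sum_(i < n | (i < s)%N) 2))%N.
  rewrite (eq_bigr (fun s : 'I_n => 1 + 2 * s))%N => [|s _]; last first.
    rewrite -(big_ord_widen n (fun=> 2%N)) ?(ltnW (ltn_ord s)) //.
    by rewrite sum_nat_const card_ord mulnC.
  elim: (n) => [|k IH]; first by rewrite big_ord0.
  by rewrite big_ord_recr -IH /=; lia.
rewrite -prod_fF; apply: (homp) => s _; apply: dhomogM => //.
apply: homp => i _; apply: rpredB; apply: (@dhomogMn _ _ _ 1 _ 2); exact: homX.
Qed.

Lemma dd_invariant_delta p : (forall pi, spsubst pi p = p) -> p@_0 = 0 ->
  dd p delta = 0.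
Proof.
move=> invp p0; have sign_even m i : p@_m != 0 -> ~~ odd (m i).
  move=> nz; apply/negP => odd_mi; have /eqP := mcoeff_flip i p m.
  rewrite invp -signr_odd odd_mi expr1 mulN1r -addr_eq0 -mulr2n mulrn_eq0 /=.
  exact/negP.
have sign_odd m i : m \in msupp delta -> odd (m i).
  rewrite mcoeff_msupp => nz; apply/negPn/negP => even_mi.
  have /eqP := mcoeff_flip i delta m.
  rewrite flip_delta mcoeffN -signr_odd (negPf even_mi) expr0 mul1r eq_sym.
  by rewrite -addr_eq0 -mulr2n mulrn_eq0 /=; apply/negP.
apply/mpolyP => k; rewrite mcoeff0; apply/eqP; rewrite mcoeff_eq0.
apply/negP => supk; have [m [nzm supmk]] := msupp_dd supk.
have odd_k i : odd (k i).
  have := sign_odd _ i supmk; rewrite mnmDE oddD.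
  by rewrite (negPf (sign_even _ i nzm)).
(* If two exponents coincide, their transposition fixes the monomial but negates p(∂) delta, so its
   coefficient is zero. *)
have inj_k : injective (fun i => (k i)./2).
  move=> i j /= eq_kij; apply/eqP/negPn/negP => neq_ij.
  have kij : k i = k j.
    by rewrite -(odd_double_half (k i)) -(odd_double_half (k j)) !odd_k eq_kij.
  have kt : [multinom k (tperm i j l) | l < n] = k.
    by apply/mnmP => l; rewrite mnmE; case: tpermP => [->|->|].
  have := mcoeff_sym (dd p delta) (tperm i j) k.
  rewrite kt msym_dd -spsubst_unsigned invp msym_delta // raddfN mcoeffN => /eqP.
  rewrite eq_sym -addr_eq0 -mulr2n mulrn_eq0 /=; apply/negP.
  by rewrite -mcoeff_msupp.
(* Distinct odd exponents add up to at least 1 + 3 + ... + (2n - 1). *)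
have le_nn : (n * n <= mdeg k)%N.
    have /sum_uniq_geq : uniq [seq (k i)./2 | i : 'I_n].
    by rewrite map_inj_uniq ?enum_uniq.
  rewrite size_image card_ord big_map big_enum /= mdegE.
  have -> : (\sum_i k i = n + 2 * \sum_(i : 'I_n) (k i)./2)%N.
    rewrite (eq_bigr (fun i => 1 + 2 * (k i)./2))%N => [|i _].
      by rewrite big_split /= sum1_card card_ord -big_distrr.
    by rewrite -{1}(odd_double_half (k i)) odd_k mul2n.
  by move: (\sum_(_ < _) _)%N => S; case: (n) => // l; nia.
have /dhomogP/(_ _ supmk) := dhomog_delta; rewrite /= mdegD => Em.
have : mdeg m == 0%N by rewrite -leqn0; move: Em le_nn; lia.
by rewrite mdeg_eq0 => /eqP m0; rewrite m0 p0 eqxx in nzm.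
Qed.

Lemma invariant_eT pi (k : nat) : spsubst pi (eT C setT k) = eT C setT k.
Proof.
rewrite /eT /spsubst -[LHS]/(comp_mpoly _ _) -coef_map /=; congr ((polyseq _)`_ _).
rewrite /charT rmorph_prod [RHS](reindex_inj (@perm_inj _ pi.1)) /=.
apply: eq_big => [i|i _]; first by rewrite !inE.
rewrite rmorphB /= map_polyX map_polyC /= rmorphXn /= tnth_spsubst.
by rewrite exprZn /sgn_of sqrr_sign scale1r.
Qed.

Lemma ann_es_delta : ann (es C setT n) delta.
Proof.
move=> a /mapP[k]; rewrite mem_iota add1n ltnS => kn ->.
apply: dd_invariant_delta => [pi|]; first exact: invariant_eT.
by apply: mcoeff0_eT; rewrite cardsT card_ord.
Qed.

Lemma ann_gF_delta (J : {set 'I_n}) h : ann (es C setT n) h ->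
    (forall s, s \in J -> dd (gF C J s) h = 0) ->
  exists a, h = dd a (dd (\prod_(s in J) fF C s) delta).
Proof.
apply: ann_gF; first exact: ann_es_delta.
by rewrite prod_fF dd_delta_neq0.
Qed.

End Delta.

(** * Contraction and multiplication operators on superspace *)

Section Super.
Context (n : nat) (C : numClosedFieldType).
Implicit Types (p q : {mpoly C[n]}) (f g h u v w : Omega n C).
Implicit Types (i j r s : 'I_n) (k : nat) (S T U : {set 'I_n}).

Definition xdd p w : Omega n C := [ffun S : {set 'I_n} => dd p (w S)].
Definition pmul p w : Omega n C := [ffun S : {set 'I_n} => p * w S].
(** The parity involution; it records the sign for moving an odd operator past a form. *)
Definition tw w : Omega n C := [ffun S : {set 'I_n} => (-1) ^+ #|S| * w S].
Definition thetaDs S w : Omega n C := foldr (@thetaD n C) w (enum S).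

(** Left and right multiplication by θ_i in coordinates: the sign counts the indices of U that θ_i
    crosses to reach its sorted place. *)
Definition Lmul i w : Omega n C := [ffun U : {set 'I_n} =>
  if i \in U then (-1) ^+ #|[set t in U | (t < i)%N]| * w (U :\ i) else 0].
Definition Rmul i w : Omega n C := [ffun U : {set 'I_n} =>
  if i \in U then (-1) ^+ #|[set t in U | (i < t)%N]| * w (U :\ i) else 0].

Lemma dd_sign k p q : dd p ((-1) ^+ k * q) = (-1) ^+ k * dd p q.
Proof. by rewrite -signr_odd !mulr_sign; case: odd; rewrite ?raddfN. Qed.

Lemma dd_signl k p q : dd ((-1) ^+ k * p) q = (-1) ^+ k * dd p q.
Proof. by rewrite -signr_odd !mulr_sign; case: odd; rewrite ?ddNl. Qed.

Lemma thetaD_is_additive i : additive (@thetaD n C i).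
Proof.
move=> u v; apply/ffunP => T; rewrite !ffunE; case: ifP => _.
  by rewrite subr0.
by rewrite mulrBr.
Qed.
HB.instance Definition _ i := GRing.isAdditive.Build _ _ _ (thetaD_is_additive i).

Lemma xdd_is_additive p : additive (xdd p).
Proof. by move=> u v; apply/ffunP => T; rewrite !ffunE raddfB. Qed.
HB.instance Definition _ p := GRing.isAdditive.Build _ _ _ (xdd_is_additive p).

Lemma pmul_is_additive p : additive (pmul p).
Proof. by move=> u v; apply/ffunP => T; rewrite !ffunE mulrBr. Qed.
HB.instance Definition _ p := GRing.isAdditive.Build _ _ _ (pmul_is_additive p).

Lemma tw_is_additive : additive tw.
Proof. by move=> u v; apply/ffunP => T; rewrite !ffunE mulrBr. Qed.
HB.instance Definition _ := GRing.isAdditive.Build _ _ _ tw_is_additive.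

Lemma Lmul_is_additive i : additive (Lmul i).
Proof.
move=> u v; apply/ffunP => T; rewrite !ffunE; case: ifP => _.
  by rewrite mulrBr.
by rewrite subr0.
Qed.
HB.instance Definition _ i := GRing.isAdditive.Build _ _ _ (Lmul_is_additive i).

Lemma Rmul_is_additive i : additive (Rmul i).
Proof.
move=> u v; apply/ffunP => T; rewrite !ffunE; case: ifP => _.
  by rewrite mulrBr.
by rewrite subr0.
Qed.
HB.instance Definition _ i := GRing.isAdditive.Build _ _ _ (Rmul_is_additive i).

Lemma thetaDs_is_additive S : additive (thetaDs S).
Proof.
by move=> u v; rewrite /thetaDs; elim: (enum S) => //= i l ->; rewrite raddfB.
Qed.
HB.instance Definition _ S := GRing.isAdditive.Build _ _ _ (thetaDs_is_additive S).

Lemma xddM p q w : xdd (p * q) w = xdd p (xdd q w).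
Proof. by apply/ffunP => T; rewrite !ffunE ddM. Qed.
Lemma xddC p q w : xdd p (xdd q w) = xdd q (xdd p w).
Proof. by rewrite -!xddM mulrC. Qed.
Lemma xdd1 w : xdd 1 w = w.
Proof. by apply/ffunP => T; rewrite !ffunE dd1. Qed.
Lemma xdd0l w : xdd 0 w = 0.
Proof. by apply/ffunP => T; rewrite !ffunE dd0l. Qed.
Lemma xddDl p q w : xdd (p + q) w = xdd p w + xdd q w.
Proof. by apply/ffunP => T; rewrite !ffunE ddDl. Qed.
Lemma xddNl p w : xdd (- p) w = - xdd p w.
Proof. by apply/ffunP => T; rewrite !ffunE ddNl. Qed.
Lemma xdd_suml I (r : seq I) (P : pred I) (F : I -> {mpoly C[n]}) w :
  xdd (\sum_(i <- r | P i) F i) w = \sum_(i <- r | P i) xdd (F i) w.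
Proof.
by apply: (big_morph (fun a => xdd a w)) => [a b|]; rewrite ?xddDl ?xdd0l.
Qed.
Lemma xdd_signl k p w : xdd ((-1) ^+ k * p) w = (-1) ^+ k *: xdd p w.
Proof.
rewrite -signr_odd -[(-1) ^+ k in RHS]signr_odd mulr_sign scaler_sign.
by case: odd; rewrite ?xddNl.
Qed.
Lemma xdd_sign k p w : xdd p ((-1) ^+ k *: w) = (-1) ^+ k *: xdd p w.
Proof. by rewrite -[(-1) ^+ k]signr_odd !scaler_sign; case: odd; rewrite ?raddfN. Qed.
Lemma thetaD_sign k i w : thetaD i ((-1) ^+ k *: w) = (-1) ^+ k *: thetaD i w.
Proof. by rewrite -[(-1) ^+ k]signr_odd !scaler_sign; case: odd; rewrite ?raddfN. Qed.

Lemma thetaD_xdd i p w : thetaD i (xdd p w) = xdd p (thetaD i w).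
Proof.
by apply/ffunP => T; rewrite !ffunE; case: (i \in T); rewrite ?raddf0 ?dd_sign.
Qed.

Lemma thetaDs_xdd S p w : thetaDs S (xdd p w) = xdd p (thetaDs S w).
Proof.
by rewrite /thetaDs; elim: (enum S) => //= i l ->; rewrite thetaD_xdd.
Qed.

Lemma thetaD_tw i w : thetaD i (tw w) = - tw (thetaD i w).
Proof.
apply/ffunP => T; rewrite !ffunE; case: ifP => iT; first by rewrite mulr0 oppr0.
by rewrite cardsU1 iT add1n exprS; ring.
Qed.

Lemma card_setU1_lt i S (P : pred 'I_n) : i \notin S ->
  #|[set t in i |: S | P t]| = (P i + #|[set t in S | P t]|)%N.
Proof.
move=> iS; rewrite (cardsD1 i) !inE eqxx /=; congr (_ + _)%N.
apply: eq_card => t; rewrite !inE; case: eqP => //= ->.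
by rewrite (negPf iS).
Qed.

Lemma thetaD_anti i j w : thetaD i (thetaD j w) = - thetaD j (thetaD i w).
Proof.
apply/ffunP => T; rewrite !ffunE !inE.
case iT: (i \in T); case jT: (j \in T); rewrite ?orbT ?mulr0 ?oppr0 //=.
have [->|neq_ij] := eqVneq i j; first by rewrite /= mulr0 oppr0.
rewrite /= setUCA.
rewrite !card_setU1_lt ?iT ?jT //.
have := neq_ij; rewrite -val_eqE /= !exprD.
by case: ltngtP => // _ _; rewrite ?expr0 ?expr1; ring.
Qed.

Lemma thetaD_sqr0 i w : thetaD i (thetaD i w) = 0.
Proof.
apply/ffunP => T; rewrite !ffunE !inE eqxx /= mulr0.
by case: ifP.
Qed.

(** Strictly increasing lists with the same members are equal. A new minimum thus becomes the head
    of every fold over [enum]. *)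
Lemma enum_setU1_min r S : (forall s, s \in S -> (r < s)%N) ->
  enum (r |: S) = r :: enum S.
Proof.
move=> ltrS; have rS : r \notin S by apply/negP => /ltrS; rewrite ltnn.
have srt T : sorted ltn (map val (enum T)).
  rewrite {1}/enum_mem -enumT; apply: (subseq_sorted ltn_trans (s2 := map val (enum 'I_n))).
    by apply: map_subseq; apply: filter_subseq.
  by rewrite val_enum_ord iota_ltn_sorted.
apply: (inj_map val_inj); apply: (irr_sorted_eq ltn_trans ltnn) => //.
  have := srt S; rewrite /= path_min_sorted // all_map; apply/allP => s.
  by rewrite mem_enum => /ltrS.
move=> x; rewrite inE; apply/mapP/predU1P => [[s]|].
  by rewrite mem_enum !inE => /predU1P[->|Ss] ->; [left | right; rewrite map_f ?mem_enum].
case=> [->|/mapP[s Ss ->]]; first by exists r; rewrite // mem_enum setU11.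
by exists s => //; rewrite mem_enum !inE -(mem_enum S) Ss orbT.
Qed.

Lemma thetaDs0 w : thetaDs set0 w = w.
Proof. by rewrite /thetaDs enum_set0. Qed.

Lemma thetaDsU1 r S w : (forall s, s \in S -> (r < s)%N) ->
  thetaDs (r |: S) w = thetaD r (thetaDs S w).
Proof. by move=> ltrS; rewrite /thetaDs enum_setU1_min. Qed.

Lemma thetaDs1 r w : thetaDs [set r] w = thetaD r w.
Proof. by rewrite -[[set r]]setU0 thetaDsU1 ?thetaDs0 // => s; rewrite inE. Qed.

Lemma thetaD_thetaDs s U w : thetaD s (thetaDs U w) =
  if s \in U then 0
  else (-1) ^+ #|[set t in U | (t < s)%N]| *: thetaDs (s |: U) w.
Proof.
elim/set_min_ind: U => [|U r ltrU IH].
  rewrite inE thetaDs0 setU0 thetaDs1 (_ : [set _ in _ | _] = set0) ?cards0 ?scale1r //.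
  by apply/setP => t; rewrite !inE.
have rU : r \notin U by apply/negP => /ltrU; rewrite ltnn.
rewrite thetaDsU1 // !inE; have [->|neq_sr] := eqVneq s r; first exact: thetaD_sqr0.
rewrite card_setU1_lt //=; case: (ltngtP s r) neq_sr => [lt_sr _|lt_rs _|/val_inj ->]; last first.
- by rewrite eqxx.
- rewrite thetaD_anti IH; case: ifP => sU; first by rewrite raddf0 oppr0.
  rewrite thetaD_sign -thetaDsU1 => [|t]; last by rewrite !inE => /predU1P[->|/ltrU].
  by rewrite setUCA add1n exprS mulN1r scaleNr.
have lt_sU t : t \in r |: U -> (s < t)%N.
  by rewrite !inE => /predU1P[->//|/ltrU]; apply: ltn_trans.
have -> : (s \in U) = false by apply/negP => /ltrU; rewrite ltnNge ltnW.
rewrite -thetaDsU1 // -thetaDsU1 // add0n (_ : [set _ in _ | _] = set0) ?cards0 ?scale1r //.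
apply/setP => t; rewrite !inE; apply/negP => /andP[/ltrU ltrt ltts].
by have := ltn_trans (ltn_trans ltrt ltts) lt_sr; rewrite ltnn.
Qed.

Definition inversions S T := #|[set p in setX S T | (p.2 < p.1)%N]|.

Lemma inversions0 T : inversions set0 T = 0%N.
Proof. by apply/eqP; rewrite cards_eq0; apply/eqP/setP => p; rewrite !inE. Qed.

Lemma inversionsU1 r S T : r \notin S -> inversions (r |: S) T =
  (#|[set t in T | (t < r)%N]| + inversions S T)%N.
Proof.
move=> rS; rewrite /inversions.
rewrite -(cardsID [set p : 'I_n * 'I_n | p.1 == r] [set p in _ | _]).
congr (_ + _)%N.
  rewrite -[RHS](card_imset _ (f := fun t => (r, t))) => [|a b []//].
  apply: eq_card => -[a b]; rewrite !inE /=; apply/idP/imsetP => [|[t]].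
    by case/andP => /andP[/andP[_ Tb] ltba] /eqP ea; exists b; rewrite ?inE -?ea ?Tb.
  by rewrite !inE => /andP[Tt ltt] [-> ->]; rewrite eqxx Tt ltt.
apply: eq_card => -[a b]; rewrite !inE /=.
by case: eqP => //= ->; rewrite (negPf rS).
Qed.

(** The ∂^θ_i anticommute and square to zero just as the θ_i do, so composites carry exactly the
    sign of the product of θ_S and θ_T. *)
Lemma thetaDs_comp S T w : thetaDs S (thetaDs T w) =
  if [disjoint S & T] then (-1) ^+ inversions S T *: thetaDs (S :|: T) w else 0.
Proof.
elim/set_min_ind: S => [|S r ltrS IH].
  by rewrite thetaDs0 inversions0 scale1r set0U disjoints_subset sub0set.
have rS : r \notin S by apply/negP => /ltrS; rewrite ltnn.
rewrite thetaDsU1 // IH !disjoints_subset subUset sub1set inE.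
case: (S \subset ~: T); last by rewrite andbF raddf0.
rewrite thetaD_sign thetaD_thetaDs inE (negPf rS) /= andbT.
case: ifP => rT; rewrite /= ?scaler0 // scalerA -exprD inversionsU1 // setUA.
congr ((-1) ^+ _ *: _); rewrite addnC; congr (_ + _)%N; apply: eq_card => t.
rewrite !inE; case tS: (t \in S) => //=.
have := ltrS t tS; case: ltngtP => //; rewrite ?andbF //.
Qed.

End Super.

(** * The ⊙-action and its commutation with the operators d_k *)

Section Action.
Context (n : nat) (C : numClosedFieldType).
Implicit Types (p q : {mpoly C[n]}) (f g h u v w : Omega n C).
Implicit Types (i r s : 'I_n) (j k : nat) (S T U : {set 'I_n}) (pi : signedPerm n).

Lemma odotE f g : odot f g = \sum_S xdd (f S) (thetaDs S g).
Proof.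
apply: eq_bigr => S _; apply/ffunP => T; rewrite sum_ffunE !ffunE.
by apply: eq_bigr => m _; rewrite !ffunE.
Qed.

(** Substituting derivatives is an algebra homomorphism. It is what reduces annihilation by the
    ideal to annihilation by its generators. *)
Lemma odot_omul f g h : odot (omul f g) h = odot f (odot g h).
Proof.
rewrite !odotE.
under eq_bigr => U _ do rewrite ffunE xdd_suml.
rewrite (exchange_big_dep predT) //=; apply: eq_bigr => S _.
rewrite raddf_sum raddf_sum /= [RHS](bigID (fun T => [disjoint S & T])) /=.
rewrite [X in _ = _ + X]big1 => [|T /negPf dST]; last first.
  by rewrite thetaDs_xdd thetaDs_comp dST !raddf0.
rewrite addr0 (reindex_onto (fun T => S :|: T) (fun U => U :\: S)) /=; last first.
  move=> U /subsetP SU; apply/setP => t; rewrite !inE.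
  by case tS: (t \in S); rewrite //= SU.
apply: eq_big => [T|T /andP[_ /eqP E]]; last first.
  have dST : [disjoint S & T].
    rewrite disjoint_sym; apply/setDidPl.
    by rewrite -[RHS]E setDUl setDv set0U.
  rewrite E thetaDs_xdd thetaDs_comp dST xdd_sign.
  by rewrite -[sgnST _ _ _]/((-1) ^+ inversions _ _) -mulrA xdd_signl xddM xdd_sign.

rewrite subsetUl setDUl setDv set0U disjoint_sym /=.
by apply/eqP/idP => /setDidPl.
Qed.

Lemma inversions_set1r S i : inversions S [set i] = #|[set t in S | (i < t)%N]|.
Proof.
rewrite /inversions -[RHS](card_imset _ (f := fun t => (t, i))) => [|a b []//].
apply: eq_card => -[a b]; rewrite !inE /=; apply/idP/imsetP => [|[t]].
  by case/andP => /andP[Sa /eqP ->] lt; exists a; rewrite ?inE ?Sa.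
by rewrite !inE => /andP[St lt] [-> ->]; rewrite eqxx St lt.
Qed.

Lemma inversions_set1l T i : inversions [set i] T = #|[set t in T | (t < i)%N]|.
Proof.
by rewrite -[[set i]]setU0 inversionsU1 ?inE // inversions0 addn0.
Qed.

Lemma card_setD1_lt i S (P : pred 'I_n) : ~~ P i ->
  #|[set t in S :\ i | P t]| = #|[set t in S | P t]|.
Proof.
move=> Pi; apply: eq_card => t; rewrite !inE.
by case: eqP => [->|//]; rewrite (negPf Pi) !andbF.
Qed.

Lemma omul_theta f i : omul f (theta C i) = Rmul i f.
Proof.
apply/ffunP => U; rewrite !ffunE; case: ifP => iU; last first.
  rewrite big1 // => S SU; rewrite ffunE; case: eqP => [E|]; last by rewrite mulr0.
  by have := set11 i; rewrite -E inE iU andbF.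
rewrite (bigD1 (U :\ i)) ?subsetDl //= big1 => [|S /andP[SU neS]]; last first.
  rewrite ffunE; case: eqP => [E|]; last by rewrite mulr0.
  case/eqP: neS; rewrite -E setDDr setDv set0U.
  by apply/esym/setIidPr.
rewrite addr0 ffunE setDDr setDv set0U (setIidPr _) ?sub1set // eqxx mulr1.
by rewrite -[sgnST _ _ _]/((-1) ^+ inversions _ _) inversions_set1r card_setD1_lt ?ltnn.
Qed.

Lemma theta_omul i f : omul (theta C i) f = Lmul i f.
Proof.
apply/ffunP => U; rewrite !ffunE; case: ifP => iU; last first.
  rewrite big1 // => S SU; rewrite ffunE; case: eqP => [E|]; last by rewrite mulr0 mul0r.
  by move: SU; rewrite E sub1set iU.
rewrite (bigD1 [set i]) ?sub1set //= big1 => [|S /andP[SU neS]]; last first.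
  by rewrite ffunE (negPf neS) mulr0 mul0r.
rewrite addr0 ffunE eqxx mulr1.
by rewrite -[sgnST _ _ _]/((-1) ^+ inversions _ _) inversions_set1l card_setD1_lt ?ltnn.
Qed.

Lemma pemb_omul p f : omul (pemb p) f = pmul p f.
Proof.
apply/ffunP => U; rewrite !ffunE (bigD1 set0) ?sub0set //= big1 => [|S /andP[_ neS]]; last first.
  by rewrite ffunE (negPf neS) mulr0 mul0r.
rewrite addr0 ffunE eqxx setD0.
by rewrite -[sgnST _ _ _]/((-1) ^+ inversions _ _) inversions0 mul1r.
Qed.

Lemma iter_xD i k f : iter k (xD i) f = xdd ('X_i ^+ k) f.
Proof.
elim: k => [|k IH]; first by rewrite expr0 xdd1.
by rewrite iterS IH exprS xddM; apply/ffunP => T; rewrite !ffunE ddX mderivmU1m.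
Qed.

Lemma dopE k f : dop k f = \sum_i Rmul i (xdd ('X_i ^+ k) f).
Proof. by apply: eq_bigr => i _; rewrite iter_xD omul_theta. Qed.

Lemma Rmul_xdd i p w : Rmul i (xdd p w) = xdd p (Rmul i w).
Proof.
by apply/ffunP => T; rewrite !ffunE; case: (i \in T); rewrite ?raddf0 ?dd_sign.
Qed.

Lemma setU1D1 i s S : i != s -> (i |: S) :\ s = i |: (S :\ s).
Proof.
by move=> neq_is; apply/setP => t; rewrite !inE; case: (eqVneq t i) => [->|//]; rewrite neq_is.
Qed.

Lemma card_lt_gt i S : i \notin S ->
  (#|[set t in S | (t < i)%N]| + #|[set t in S | (i < t)%N]|)%N = #|S|.
Proof.
move=> iS; rewrite -(cardsID [set t : 'I_n | (t < i)%N] S); congr (_ + _)%N.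
  by apply: eq_card => t; rewrite !inE.
apply: eq_card => t; rewrite !inE; case tS: (t \in S) => //=; rewrite ?andbF //.
rewrite -leqNgt andbT ltn_neqAle; case: eqP => //= /val_inj E.
by rewrite E tS in iS.
Qed.

(** ∂^θ_s is an antiderivation from the left, so it reaches a θ_i placed on the right only after
    crossing [u]; hence the parity twist. *)
Lemma thetaD_Rmul s i u :
  thetaD s (Rmul i u) = Rmul i (thetaD s u) + (if s == i then tw u else 0).
Proof.
apply/ffunP => T; rewrite !ffunE; have [->|neq_si] := eqVneq s i.
  rewrite !ffunE !inE eqxx /=; case iT: (i \in T).
    rewrite setD1K // (cardsD1 i T) iT -(card_lt_gt (i := i) (S := T :\ i)) ?inE ?eqxx //.
    rewrite !card_setD1_lt ?ltnn // mulrA -exprD addrC -mulrDl.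
    by rewrite add1n exprS mulN1r addnC addNr mul0r.
  rewrite setU1K ?iT // add0r mulrA -exprD card_setU1_lt ?iT // ltnn add0n.
  by rewrite card_lt_gt ?iT.
rewrite [X in _ = _ + X]ffunE addr0 !inE [i == s]eq_sym (negPf neq_si) /=.
case iT: (i \in T); case sT: (s \in T); rewrite ?mulr0 //=.
rewrite card_setU1_lt ?sT // setU1D1 //.
have -> : #|[set t in T | (t < s)%N]| = ((i < s) + #|[set t in T :\ i | (t < s)%N]|)%N.
  by rewrite -[in LHS](setD1K iT) card_setU1_lt ?inE ?eqxx.
have := neq_si; rewrite -val_eqE /= !exprD.
by case: ltngtP => // _ _; rewrite ?expr0 ?expr1; ring.
Qed.

Lemma tw_xdd p w : tw (xdd p w) = xdd p (tw w).
Proof. by apply/ffunP => T; rewrite !ffunE dd_sign. Qed.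

Lemma tw_thetaDs S w : tw (thetaDs S w) = (-1) ^+ #|S| *: thetaDs S (tw w).
Proof.
elim/set_min_ind: S => [|S r ltrS IH]; first by rewrite !thetaDs0 cards0 scale1r.
have rS : r \notin S by apply/negP => /ltrS; rewrite ltnn.
rewrite !thetaDsU1 // cardsU1 rS add1n exprS mulN1r scaleNr -thetaD_sign -IH.
by rewrite thetaD_tw opprK.
Qed.

Lemma dop_is_additive k : additive (@dop n C k).
Proof.
move=> u v; rewrite !dopE -sumrB; apply: eq_bigr => i _.
by rewrite raddfB raddfB.
Qed.
HB.instance Definition _ k := GRing.isAdditive.Build _ _ _ (dop_is_additive k).

Lemma dop_xdd k p w : dop k (xdd p w) = xdd p (dop k w).
Proof.
by rewrite !dopE raddf_sum; apply: eq_bigr => i _; rewrite xddC Rmul_xdd.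
Qed.

Lemma thetaD_dop s k w :
  thetaD s (dop k w) = dop k (thetaD s w) + xdd ('X_s ^+ k) (tw w).
Proof.
rewrite !dopE raddf_sum /=; under eq_bigr => i _ do rewrite thetaD_Rmul thetaD_xdd.
rewrite big_split; congr (_ + _); rewrite (bigD1 s) //= eqxx big1 ?addr0 ?tw_xdd //.
by move=> i; rewrite eq_sym => /negPf ->.
Qed.

Lemma thetaDs_dop S k w : thetaDs S (dop k w) = dop k (thetaDs S w) +
  \sum_(i in S) (-1) ^+ #|[set t in S | (i < t)%N]| *:
    xdd ('X_i ^+ k) (thetaDs (S :\ i) (tw w)).
Proof.
elim/set_min_ind: S => [|S r ltrS IH]; first by rewrite !thetaDs0 big_set0 addr0.
have rS : r \notin S by apply/negP => /ltrS; rewrite ltnn.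
rewrite !thetaDsU1 // IH raddfD /= thetaD_dop -addrA; congr (_ + _).
rewrite big_setU1 //= tw_thetaDs xdd_sign setU1K //; congr (_ + _).
  congr ((-1) ^+ _ *: _); apply: eq_card => t; rewrite !inE.
  case: eqP => [->|_]; first by rewrite ltnn (negPf rS).
  by case tS: (t \in S); rewrite // ltrS.
rewrite raddf_sum; apply: eq_bigr => i Si /=; rewrite thetaD_sign thetaD_xdd.
have neq_ri : r != i by apply: contraNneq rS => ->.
rewrite setU1D1 // thetaDsU1 => [|t]; last by rewrite inE => /andP[_ /ltrS].
rewrite card_setU1_lt //= (_ : (i < r)%N = false) //.
by apply/negbTE; rewrite -leqNgt ltnW ?ltrS.
Qed.

Lemma sum_setD1 (V : zmodType) (F : {set 'I_n} -> 'I_n -> V) :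
  \sum_(S : {set 'I_n}) \sum_(i in S) F S i =
  \sum_(T : {set 'I_n}) \sum_(i | i \notin T) F (i |: T) i.
Proof.
rewrite (exchange_big_dep predT) //= [RHS](exchange_big_dep predT) //=.
apply: eq_bigr => i _.
rewrite (reindex_onto (fun T => i |: T) (fun S => S :\ i)) /= => [|S]; last exact: setD1K.
apply: eq_bigl => T; rewrite setU11 /=; apply/eqP/idP => [<-|/setU1K //].
by rewrite !inE eqxx.
Qed.

(** The odd derivation sending θ_i to x_i^k; it describes what remains of g when d_k is commuted
    past g ⊙. *)
Definition Eop k g : Omega n C := \sum_i pmul ('X_i ^+ k) (thetaD i g).

Lemma EopE k g T : Eop k g T =
  \sum_(i | i \notin T) (-1) ^+ #|[set t in T | (t < i)%N]| * ('X_i ^+ k * g (i |: T)).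
Proof.
rewrite /Eop sum_ffunE [RHS]big_mkcond; apply: eq_bigr => i _.
by rewrite !ffunE; case: (i \in T); rewrite ?mulr0 // mulrCA.
Qed.

(** A θ-derivative in [g] either passes the θ_i supplied by d_k or removes it; in the second case
    θ_i in [g] is traded for x_i^k. *)
Lemma odot_dop k g w :
  odot g (dop k w) = dop k (odot g w) + odot (tw (Eop k g)) (tw w).
Proof.
rewrite !odotE raddf_sum /=.
under eq_bigr => S _ do rewrite thetaDs_dop raddfD /= -dop_xdd raddf_sum.
rewrite big_split /=; congr (_ + _); rewrite sum_setD1; apply: eq_bigr => T _.
rewrite ffunE EopE mulr_sumr xdd_suml; apply: eq_bigr => i iT.
rewrite xdd_sign setU1K // -xddM card_setU1_lt // ltnn add0n mulrA -exprD xdd_signl.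
(* Splitting #|T| at i counts the indices below i twice, leaving the sign for those above i. *)
rewrite mulrC; congr (_ *: _); rewrite -(card_lt_gt iT) addnAC exprD.
by rewrite addnn -[_ ^+ _.*2]signr_odd odd_double expr0 mul1r.
Qed.

End Action.

(** * Signed permutations on superspace and the forms killed by invariants *)

Section Harmonic.
Context (n : nat) (C : numClosedFieldType).
Implicit Types (p q : {mpoly C[n]}) (f g h u v w : Omega n C).
Implicit Types (i r s : 'I_n) (j k : nat) (S T U : {set 'I_n}) (pi : signedPerm n).

Definition thetaP pi S : Omega n C :=
  oprod [seq sgn_of C pi i *: theta C (pi.1 i) | i <- enum S].

Lemma omulZl (c : C) f g : omul (c *: f) g = c *: omul f g.
Proof.
apply/ffunP => U; rewrite !ffunE scaler_sumr; apply: eq_bigr => S _.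
by rewrite ffunE -scalerAr -scalerAl.
Qed.

Lemma thetaP0 pi : thetaP pi set0 = pemb 1.
Proof. by rewrite /thetaP enum_set0. Qed.

Lemma thetaPU1 pi r S : (forall s, s \in S -> (r < s)%N) ->
  thetaP pi (r |: S) = sgn_of C pi r *: Lmul (pi.1 r) (thetaP pi S).
Proof.
by move=> ltrS; rewrite /thetaP enum_setU1_min //= omulZl theta_omul.
Qed.

Lemma actE pi f : Defs.act pi f = \sum_S pmul (spsubst pi (f S)) (thetaP pi S).
Proof. by apply: eq_bigr => S _; rewrite pemb_omul. Qed.

Lemma pmulZr (c : C) p w : pmul p (c *: w) = c *: pmul p w.
Proof. by apply/ffunP => T; rewrite !ffunE scalerAr. Qed.
Lemma pmulZl (c : C) p w : pmul (c *: p) w = c *: pmul p w.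
Proof. by apply/ffunP => T; rewrite !ffunE scalerAl. Qed.
Lemma pmulM p q w : pmul (p * q) w = pmul p (pmul q w).
Proof. by apply/ffunP => T; rewrite !ffunE mulrA. Qed.
Lemma pmul0l w : pmul 0 w = 0.
Proof. by apply/ffunP => T; rewrite !ffunE mul0r. Qed.
Lemma pmulDl p q w : pmul (p + q) w = pmul p w + pmul q w.
Proof. by apply/ffunP => T; rewrite !ffunE mulrDl. Qed.
Lemma pmul_suml I (r : seq I) (P : pred I) (F : I -> {mpoly C[n]}) w :
  pmul (\sum_(i <- r | P i) F i) w = \sum_(i <- r | P i) pmul (F i) w.
Proof.
by apply: (big_morph (fun a => pmul a w)) => [a b|]; rewrite ?pmulDl ?pmul0l.
Qed.
Lemma pmul_signl k p w : pmul ((-1) ^+ k * p) w = (-1) ^+ k *: pmul p w.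
Proof.
rewrite -signr_odd -[(-1) ^+ k in RHS]signr_odd mulr_sign scaler_sign.
case: odd => //; rewrite -mulN1r pmulM.
by apply/ffunP => T; rewrite !ffunE mulN1r.
Qed.
Lemma Lmul_sign i k w : Lmul i ((-1) ^+ k *: w) = (-1) ^+ k *: Lmul i w.
Proof. by rewrite -[(-1) ^+ k]signr_odd !scaler_sign; case: odd; rewrite ?raddfN. Qed.
Lemma tw_sign k w : tw ((-1) ^+ k *: w) = (-1) ^+ k *: tw w.
Proof. by rewrite -[(-1) ^+ k]signr_odd !scaler_sign; case: odd; rewrite ?raddfN. Qed.
Lemma Lmul_pmul i p w : Lmul i (pmul p w) = pmul p (Lmul i w).
Proof.
by apply/ffunP => T; rewrite !ffunE; case: (i \in T); rewrite ?mulr0 // mulrCA.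
Qed.
Lemma thetaD_pmul i p w : thetaD i (pmul p w) = pmul p (thetaD i w).
Proof.
by apply/ffunP => T; rewrite !ffunE; case: (i \in T); rewrite ?mulr0 // mulrCA.
Qed.
Lemma tw_pmul p w : tw (pmul p w) = pmul p (tw w).
Proof. by apply/ffunP => T; rewrite !ffunE mulrCA. Qed.

Lemma tw_Lmul i w : tw (Lmul i w) = - Lmul i (tw w).
Proof.
apply/ffunP => T; rewrite !ffunE; case: ifP => iT; last by rewrite mulr0 oppr0.
by rewrite (cardsD1 i T) iT add1n exprS; ring.
Qed.

Lemma thetaD_Lmul s i u :
  thetaD s (Lmul i u) = (if s == i then u else 0) - Lmul i (thetaD s u).
Proof.
apply/ffunP => T; rewrite !ffunE; have [->|neq_si] := eqVneq s i.
  rewrite !inE eqxx /=; case iT: (i \in T).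
    rewrite setD1K // card_setD1_lt ?ltnn // mulrA -expr2 sqrr_sign mul1r.
    by rewrite subrr.
  rewrite setU1K ?iT // card_setU1_lt ?iT // ltnn add0n subr0.
  by rewrite mulrA -expr2 sqrr_sign mul1r.
rewrite [X in _ = X + _]ffunE add0r !inE [i == s]eq_sym (negPf neq_si) /=.
case iT: (i \in T); case sT: (s \in T); rewrite ?mulr0 ?oppr0 //=.
rewrite card_setU1_lt ?sT // setU1D1 //.
have -> : #|[set t in T | (t < s)%N]| = ((i < s) + #|[set t in T :\ i | (t < s)%N]|)%N.
  by rewrite -[in LHS](setD1K iT) card_setU1_lt ?inE ?eqxx.
have := neq_si; rewrite -val_eqE /= !exprD.
by case: ltngtP => // _ _; rewrite ?expr0 ?expr1; ring.
Qed.

Lemma Eop_Lmul k i u : Eop k (Lmul i u) = pmul ('X_i ^+ k) u - Lmul i (Eop k u).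
Proof.
rewrite /Eop raddf_sum /=.
under eq_bigr => s _ do rewrite thetaD_Lmul raddfB /= -Lmul_pmul.
rewrite sumrB; congr (_ - _); rewrite (bigD1 i) //= eqxx big1 ?addr0 //.
by move=> s /negPf ->; rewrite raddf0.
Qed.

Lemma Eop_pmul k p u : Eop k (pmul p u) = pmul p (Eop k u).
Proof.
rewrite /Eop raddf_sum; apply: eq_bigr => i _ /=.
by rewrite thetaD_pmul -!pmulM mulrC.
Qed.

Lemma Eop_is_additive k : additive (@Eop n C k).
Proof. by move=> u v; rewrite /Eop -sumrB; apply: eq_bigr => i _; rewrite !raddfB. Qed.
HB.instance Definition _ k := GRing.isAdditive.Build _ _ _ (Eop_is_additive k).

Lemma Eop_sign k l u : Eop k ((-1) ^+ l *: u) = (-1) ^+ l *: Eop k u.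
Proof. by rewrite -[(-1) ^+ l]signr_odd !scaler_sign; case: odd; rewrite ?raddfN. Qed.

Lemma spsubst_sign pi k p : spsubst pi ((-1) ^+ k * p) = (-1) ^+ k * spsubst pi p.
Proof.
by rewrite -signr_odd !mulr_sign; case: odd; rewrite // /spsubst rmorphN.
Qed.

Lemma spsubstM pi p q : spsubst pi (p * q) = spsubst pi p * spsubst pi q.
Proof. exact: rmorphM. Qed.

Lemma spsubst_sum pi I (r : seq I) (P : pred I) (F : I -> {mpoly C[n]}) :
  spsubst pi (\sum_(i <- r | P i) F i) = \sum_(i <- r | P i) spsubst pi (F i).
Proof. exact: rmorph_sum. Qed.

(** Oddness of k enters here: the sign of [pi] at i survives the power, so x_i^k transforms like
    θ_i. *)
Lemma spsubstXn pi i k : odd k ->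
  spsubst pi ('X_i ^+ k) = sgn_of C pi i *: 'X_(pi.1 i) ^+ k.
Proof.
move=> kodd; rewrite /spsubst rmorphXn /= tnth_spsubst exprZn /sgn_of.
by rewrite -exprM -[_ ^+ (_ * _)]signr_odd oddM kodd andbT oddb.
Qed.

Lemma Eop_thetaP pi k S : odd k -> Eop k (thetaP pi S) =
  \sum_(i in S) (-1) ^+ #|[set t in S | (t < i)%N]| *:
    pmul (spsubst pi ('X_i ^+ k)) (thetaP pi (S :\ i)).
Proof.
move=> kodd; elim/set_min_ind: S => [|S r ltrS IH].
  rewrite big_set0 thetaP0; apply/ffunP => T; rewrite EopE big1 ?ffunE // => i _.
  rewrite ffunE; case: eqP => [E|_]; last by rewrite !mulr0.
  by have := setU11 i T; rewrite E inE.
have rS : r \notin S by apply/negP => /ltrS; rewrite ltnn.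
rewrite thetaPU1 // {1}/sgn_of Eop_sign Eop_Lmul IH scalerBr big_setU1 //=.
congr (_ + _).
  rewrite setU1K // spsubstXn // pmulZl (_ : [set _ in _ | _] = set0) ?cards0 ?scale1r //.
  apply/setP => t; rewrite !inE; case: eqP => [->|_]; first by rewrite ltnn.
  by apply/negP => /andP[/ltrS]; lia.
rewrite raddf_sum scaler_sumr -sumrN; apply: eq_bigr => i Si /=.
have neq_ri : r != i by apply: contraNneq rS => ->.
rewrite Lmul_sign Lmul_pmul setU1D1 // thetaPU1 => [|t]; last first.
  by rewrite inE => /andP[_ /ltrS].
rewrite card_setU1_lt //= ltrS // add1n exprS mulN1r scaleNr pmulZr.
by rewrite !scalerA mulrC.
Qed.

(** For odd k, [Eop k] replaces θ_i by something with the same transformation law, hence commutes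
    with the group and preserves invariants. *)
Lemma Eop_act k pi f : odd k -> Eop k (Defs.act pi f) = Defs.act pi (Eop k f).
Proof.
move=> kodd; rewrite !actE raddf_sum /=.
under eq_bigr => S _ do rewrite Eop_pmul Eop_thetaP // raddf_sum /=.
rewrite sum_setD1; apply: eq_bigr => T _.
rewrite EopE spsubst_sum pmul_suml.
apply: eq_bigr => i iT; rewrite pmulZr setU1K // card_setU1_lt // ltnn add0n.
rewrite spsubst_sign spsubstM pmul_signl -pmulM.
by rewrite [_ * spsubst pi ('X_i ^+ k)]mulrC.
Qed.

Lemma tw_thetaP pi S : tw (thetaP pi S) = (-1) ^+ #|S| *: thetaP pi S.
Proof.
elim/set_min_ind: S => [|S r ltrS IH].
  rewrite thetaP0 cards0 scale1r; apply/ffunP => T; rewrite !ffunE.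
  by case: eqP => [->|]; rewrite ?mulr0 // cards0 mul1r.
have rS : r \notin S by apply/negP => /ltrS; rewrite ltnn.
rewrite thetaPU1 // {1}/sgn_of tw_sign tw_Lmul IH Lmul_sign cardsU1 rS add1n.
by rewrite exprS mulN1r scaleNr scalerN !scalerA mulrC.
Qed.

Lemma tw_act pi f : tw (Defs.act pi f) = Defs.act pi (tw f).
Proof.
rewrite !actE raddf_sum; apply: eq_bigr => S _ /=.
rewrite tw_pmul tw_thetaP pmulZr ffunE spsubst_sign.
by rewrite pmul_signl.
Qed.

Lemma act_set0 pi f : Defs.act pi f set0 = spsubst pi (f set0).
Proof.
rewrite actE sum_ffunE (bigD1 set0) //= big1 => [|S neS].
  by rewrite addr0 ffunE thetaP0 ffunE eqxx mulr1.
rewrite ffunE; elim/set_min_ind: S neS => [|S r ltrS _ _]; first by rewrite eqxx.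
by rewrite thetaPU1 // !ffunE inE scaler0 mulr0.
Qed.

Lemma act_pemb pi p : Defs.act pi (pemb p) = pemb (spsubst pi p).
Proof.
rewrite actE (bigD1 set0) //= big1 => [|S /negPf neS]; last first.
  by rewrite ffunE neS /spsubst rmorph0 pmul0l.
rewrite addr0 ffunE eqxx thetaP0; apply/ffunP => T; rewrite !ffunE.
by case: eqP; rewrite ?mulr1 ?mulr0.
Qed.

(** Reading θ_i as dx_i, this is the differential of the power sum of degree k + 1, divided by k +
    1. *)
Definition omega k : Omega n C := \sum_i pmul ('X_i ^+ k) (theta C i).

Lemma act_is_additive pi : additive (@Defs.act n C pi).
Proof.
move=> u v; rewrite !actE -sumrB; apply: eq_bigr => S _.
rewrite !ffunE /spsubst rmorphB /= pmulDl; congr (_ + _).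
by rewrite -mulN1r pmulM; apply/ffunP => T; rewrite !ffunE mulN1r.
Qed.
HB.instance Definition _ pi := GRing.isAdditive.Build _ _ _ (act_is_additive pi).

Lemma act_omega pi k : odd k -> Defs.act pi (omega k) = omega k.
Proof.
move=> kodd; rewrite /omega raddf_sum [RHS](reindex_inj (@perm_inj _ pi.1)) /=.
apply: eq_bigr => i _; rewrite actE (bigD1 [set i]) //= big1 => [|S /negPf neS].
  rewrite !ffunE eqxx mulr1 addr0 spsubstXn // -[[set i]]setU0 thetaPU1 ?inE //.
    rewrite thetaP0 -theta_omul pmulZl pmulZr scalerA /sgn_of -expr2 sqrr_sign.
    rewrite scale1r theta_omul; congr (pmul _ _); apply/ffunP => T.
    rewrite !ffunE setD_eq0; case: eqP => [->|neT].
      rewrite set11 subxx mulr1 (_ : [set _ in _ | _] = set0) ?cards0 //.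
      by apply/setP => t; rewrite !inE; case: eqP => [->|//]; rewrite ltnn.
    case: ifP => // iT; case: ifP => [sT|_]; last by rewrite mulr0.
    by case: neT; apply/eqP; rewrite eqEsubset sT sub1set.
  by move=> s; rewrite inE.
by rewrite !ffunE neS mulr0 /spsubst rmorph0 pmul0l.
Qed.

Definition killed w :=
  forall g, Defs.invariant g -> const_term g = 0 -> odot g w = 0.

Lemma invariant_tw g : Defs.invariant g -> Defs.invariant (tw g).
Proof. by move=> Hg pi; rewrite -tw_act Hg. Qed.

Lemma const_term_tw g : const_term (tw g) = const_term g.
Proof. by rewrite /const_term ffunE cards0 mul1r. Qed.

Lemma odot_tw g w : odot g (tw w) = tw (odot (tw g) w).
Proof.
rewrite !odotE raddf_sum; apply: eq_bigr => S _ /=.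
rewrite ffunE tw_xdd tw_thetaDs xdd_signl xdd_sign scalerA -expr2 sqrr_sign.
by rewrite scale1r.
Qed.

Lemma thetaDs_thetaD S i w :
  thetaDs S (thetaD i w) = (-1) ^+ #|S| *: thetaD i (thetaDs S w).
Proof.
elim/set_min_ind: S => [|S r ltrS IH]; first by rewrite !thetaDs0 cards0 scale1r.
have rS : r \notin S by apply/negP => /ltrS; rewrite ltnn.
rewrite !thetaDsU1 // IH thetaD_sign cardsU1 rS add1n exprS mulN1r scaleNr.
by rewrite [in RHS]thetaD_anti scalerN opprK.
Qed.

Lemma odot_thetaD g i w : odot g (thetaD i w) = thetaD i (odot (tw g) w).
Proof.
rewrite !odotE raddf_sum; apply: eq_bigr => S _ /=.
by rewrite thetaDs_thetaD ffunE thetaD_xdd xdd_signl xdd_sign.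
Qed.

Lemma odot_is_additive g : additive (@odot n C g).
Proof. by move=> u v; rewrite !odotE -sumrB; apply: eq_bigr => S _; rewrite !raddfB. Qed.
HB.instance Definition _ g := GRing.isAdditive.Build _ _ _ (odot_is_additive g).

Lemma odot_xdd g p w : odot g (xdd p w) = xdd p (odot g w).
Proof.
rewrite !odotE raddf_sum; apply: eq_bigr => S _ /=.
by rewrite thetaDs_xdd xddC.
Qed.

Lemma odot_pemb p w : odot (pemb p) w = xdd p w.
Proof.
rewrite odotE (bigD1 set0) //= big1 => [|S /negPf neS]; last first.
  by rewrite ffunE neS xdd0l.
by rewrite addr0 ffunE eqxx thetaDs0.
Qed.

Lemma odot_suml I (r : seq I) (P : pred I) (F : I -> Omega n C) w :
  odot (\sum_(i <- r | P i) F i) w = \sum_(i <- r | P i) odot (F i) w.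
Proof.
apply: (big_morph (fun a => odot a w)) => [a b|]; rewrite !odotE.
  by rewrite -big_split; apply: eq_bigr => S _; rewrite ffunE xddDl.
by rewrite big1 // => S _; rewrite ffunE xdd0l.
Qed.

Lemma killed0 : killed 0. Proof. by move=> g _ _; rewrite raddf0. Qed.
Lemma killedD u v : killed u -> killed v -> killed (u + v).
Proof. by move=> Hu Hv g ig cg; rewrite raddfD /= Hu // Hv // addr0. Qed.
Lemma killedB u v : killed u -> killed v -> killed (u - v).
Proof. by move=> Hu Hv g ig cg; rewrite raddfB /= Hu // Hv // subr0. Qed.
Lemma killed_xdd p w : killed w -> killed (xdd p w).
Proof. by move=> Hw g ig cg; rewrite odot_xdd Hw // raddf0. Qed.

Lemma killed_thetaD i w : killed w -> killed (thetaD i w).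
Proof.
move=> Hw g ig cg; rewrite odot_thetaD Hw ?raddf0 ?const_term_tw //.
exact: invariant_tw.
Qed.

Lemma killed_tw w : killed w -> killed (tw w).
Proof.
move=> Hw g ig cg; rewrite odot_tw Hw ?raddf0 ?const_term_tw //.
exact: invariant_tw.
Qed.

Lemma killed_odot f w : killed w -> killed (odot f w).
Proof.
move=> Hw; rewrite odotE; elim/big_ind: _ => [||S _]; [exact: killed0|exact: killedD|].
apply: killed_xdd; elim/set_min_ind: S => [|S r ltrS IH]; first by rewrite thetaDs0.
by rewrite thetaDsU1 //; apply: killed_thetaD.
Qed.

(** Commuting an invariant g past d_k leaves [Eop k g], again invariant; its constant term vanishes
    because every term carries some x_i^k with k > 0. *)
Lemma killed_dop k w : odd k -> killed w -> killed (dop k w).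
Proof.
move=> kodd Hw g ig cg; rewrite odot_dop Hw // raddf0 add0r.
apply: killed_tw => //; first by apply: invariant_tw => pi; rewrite -Eop_act // ig.
rewrite const_term_tw /const_term EopE raddf_sum big1 // => i _ /=.
rewrite -signr_odd mulr_sign; set x := _ * _.
have x0 : x@_0 = 0 by rewrite rmorphM /= mcoeff0_Xn ?mul0r // odd_gt0.
by case: odd; rewrite ?mcoeffN x0 ?oppr0.
Qed.

Lemma killed_delta : killed (pemb (delta n C)).
Proof.
have thetaDs_pemb S p : thetaDs S (pemb p) = if S == set0 then pemb p else 0 :> Omega n C.
  elim/set_min_ind: S => [|S r ltrS IH]; first by rewrite eqxx thetaDs0.
  rewrite thetaDsU1 // IH [RHS]ifF; last first.
    by apply/negbTE/negP => /eqP E; have := setU11 r S; rewrite E inE.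
  case: ifP => _; last by rewrite raddf0.
  apply/ffunP => T; rewrite !ffunE; case: ifP => // _.
  case: eqP => [E|_]; last by rewrite mulr0.
  by have := setU11 r T; rewrite E inE.
move=> g ig cg; rewrite odotE (bigD1 set0) //= big1 => [|S /negPf neS]; last first.
  by rewrite thetaDs_pemb neS raddf0.
rewrite addr0 thetaDs_pemb eqxx; apply/ffunP => T; rewrite !ffunE.
case: ifP => _; last by rewrite raddf0.
by apply: dd_invariant_delta => // pi; rewrite -act_set0 ig.
Qed.

(** An element a g b of the ideal acts as a ⊙ (g ⊙ (b ⊙ w)), so the point is that [killed] is stable
    under every b ⊙ ([killed_odot]). *)
Lemma SHP w : SH w <-> killed w.
Proof.
split=> [Hw g ig cg|Hw f [m [a [g [b [Hg ->]]]]]].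
  have : inSI (omul (omul (pemb 1) g) (pemb 1)).
    exists 1%N, (fun=> pemb 1), (fun=> g), (fun=> pemb 1); split=> //.
    by rewrite big_ord1.
  by move/Hw; rewrite !odot_omul !odot_pemb !xdd1.
rewrite odot_suml big1 // => i _; rewrite !odot_omul.
have [ig cg] := Hg i; rewrite (killed_odot _ Hw) ?raddf0 //.
Qed.

End Harmonic.

(** * The span of the d_I delta and elimination by leading coefficients *)

Section Span.
Context (n : nat) (C : numClosedFieldType).
Implicit Types (p q : {mpoly C[n]}) (f g h u v w : Omega n C).
Implicit Types (i r s : 'I_n) (j k : nat) (S T U K : {set 'I_n}).

Definition spanned w := exists p : {set 'I_n} -> {mpoly C[n]},
  w = \sum_(I : {set 'I_n}) odot (pemb (p I)) (dI I (deltaB n C)).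

Lemma Rmul_anti i s w : Rmul i (Rmul s w) = - Rmul s (Rmul i w).
Proof.
apply/ffunP => T; rewrite !ffunE !inE.
case iT: (i \in T); case sT: (s \in T); rewrite ?andbF ?mulr0 ?oppr0 ?andbT //=.
have [->|neq_is] := eqVneq i s; first by rewrite /= mulr0 oppr0.
rewrite /= !setDDl [[set s] :|: _]setUC.
have -> : #|[set t in T | (s < t)%N]| = ((s < i) + #|[set t in T :\ i | (s < t)%N]|)%N.
  by rewrite -[in LHS](setD1K iT) card_setU1_lt ?inE ?eqxx.
have -> : #|[set t in T | (i < t)%N]| = ((i < s) + #|[set t in T :\ s | (i < t)%N]|)%N.
  by rewrite -[in LHS](setD1K sT) card_setU1_lt ?inE ?eqxx.
have := neq_is; rewrite -val_eqE /= !exprD.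
by case: ltngtP => // _ _; rewrite ?expr0 ?expr1; ring.
Qed.

Lemma dop_dop j k w : dop j (dop k w) =
  \sum_i \sum_s Rmul i (Rmul s (xdd ('X_i ^+ j * 'X_s ^+ k) w)).
Proof.
rewrite dopE; apply: eq_bigr => i _; rewrite dopE.
rewrite [xdd _ (\sum_(_ < _) _)]raddf_sum raddf_sum.
by apply: eq_bigr => s _ /=; rewrite xddM -Rmul_xdd.
Qed.

Lemma dop_anti j k w : dop j (dop k w) = - dop k (dop j w).
Proof.
rewrite !dop_dop exchange_big -sumrN; apply: eq_bigr => s _.
rewrite -sumrN; apply: eq_bigr => i _.
by rewrite Rmul_anti mulrC.
Qed.

Lemma dop_sqr0 k w : dop k (dop k w) = 0.
Proof.
apply/eqP; have /eqP := dop_anti k k w; rewrite -addr_eq0 -mulr2n -scaler_nat.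
by rewrite scaler_eq0 pnatr_eq0.
Qed.

Lemma dop_sign j k w : dop j ((-1) ^+ k *: w) = (-1) ^+ k *: dop j w.
Proof. by rewrite -[(-1) ^+ k]signr_odd !scaler_sign; case: odd; rewrite ?raddfN. Qed.

Lemma dI0 w : dI set0 w = w.
Proof. by rewrite /dI enum_set0. Qed.

Lemma dIU1 r S w : (forall s, s \in S -> (r < s)%N) ->
  dI (r |: S) w = dop (2 * r + 1) (dI S w).
Proof. by move=> ltrS; rewrite /dI enum_setU1_min. Qed.

(** Anticommutation sorts the new operator into place; its sign is left existential because only the
    span matters. *)
Lemma dop_dI s U w : exists e, dop (2 * s + 1) (dI U w) =
  if s \in U then 0 else (-1) ^+ e *: dI (s |: U) w.
Proof.
elim/set_min_ind: U => [|U r ltrU [e IH]].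
  by exists 0%N; rewrite inE scale1r dIU1 // => t; rewrite inE.
have rU : r \notin U by apply/negP => /ltrU; rewrite ltnn.
case: (ltngtP s r) => [lt_sr|lt_rs|/val_inj ->]; last first.
- by exists 0%N; rewrite setU11 dIU1 // dop_sqr0.
- exists e.+1; rewrite dIU1 // dop_anti IH !inE.
  have -> /= : (s == r) = false by rewrite -val_eqE gtn_eqF.
  case: ifP => sU; first by rewrite raddf0 oppr0.
  rewrite dop_sign setUCA (@dIU1 r (s |: U)) => [|t].
    by rewrite exprS mulN1r scaleNr.
  by rewrite !inE => /predU1P[->|/ltrU].
have lt_sU t : t \in r |: U -> (s < t)%N.
  by rewrite !inE => /predU1P[->//|/ltrU]; apply: ltn_trans.
exists 0%N; rewrite ifF; first by rewrite scale1r -dIU1.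
by apply/negbTE/negP => /lt_sU; rewrite ltnn.
Qed.

Lemma spanned0 : spanned 0.
Proof. by exists (fun=> 0); rewrite big1 // => S _; rewrite odot_pemb xdd0l. Qed.

Lemma spannedD u v : spanned u -> spanned v -> spanned (u + v).
Proof.
move=> [p ->] [q ->]; exists (fun S => p S + q S); rewrite -big_split.
by apply: eq_bigr => S _; rewrite !odot_pemb xddDl.
Qed.

Lemma spanned_xdd p w : spanned w -> spanned (xdd p w).
Proof.
move=> [q ->]; exists (fun S => p * q S); rewrite raddf_sum.
by apply: eq_bigr => S _ /=; rewrite !odot_pemb xddM.
Qed.

Lemma spanned_sum (I : Type) (r : seq I) (P : pred I) (F : I -> Omega n C) :
  (forall x, P x -> spanned (F x)) -> spanned (\sum_(x <- r | P x) F x).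
Proof. by move=> H; elim/big_ind: _ => //; [exact: spanned0 | exact: spannedD]. Qed.

Lemma spanned_dI S : spanned (dI S (deltaB n C)).
Proof.
exists (fun T => if T == S then 1 else 0); rewrite (bigD1 S) //= eqxx big1.
  by rewrite addr0 odot_pemb xdd1.
by move=> T /negPf ->; rewrite odot_pemb xdd0l.
Qed.

Lemma spanned_dop s w : spanned w -> spanned (dop (2 * s + 1) w).
Proof.
move=> [p ->]; rewrite raddf_sum; apply: spanned_sum => S _ /=.
rewrite odot_pemb dop_xdd; apply: spanned_xdd.
have [e ->] := dop_dI s S (deltaB n C); case: ifP => _; first exact: spanned0.
rewrite -[(-1) ^+ e *: _]xdd1 xdd_sign -xdd_signl.
by apply: spanned_xdd; apply: spanned_dI.
Qed.

Lemma spanned_killed w : spanned w -> killed w.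
Proof.
move=> [p ->]; elim/big_ind: _ => [||S _]; [exact: killed0 | exact: killedD |].
rewrite odot_pemb; apply: killed_xdd.
elim/set_min_ind: S => [|S r ltrS IH]; first by rewrite dI0; apply: killed_delta.
by rewrite dIU1 //; apply: killed_dop; rewrite // oddD mul2n odd_double.
Qed.

(* [P] stands for the odd polynomial q(t) = t P(t^2): this is the operator
   f |-> sum_i q(∂_i)(f) theta_i. *)
Definition dpoly (P : {poly {mpoly C[n]}}) w : Omega n C :=
  \sum_i Rmul i (xdd ('X_i * P.['X_i ^+ 2]) w).

Lemma horner_odd (P : {poly {mpoly C[n]}}) m i : (size P <= m)%N ->
  'X_i * P.['X_i ^+ 2] = \sum_(j < m) P`_j * 'X_i ^+ (2 * j + 1).
Proof.
move=> le_m; rewrite (horner_coef_wide _ le_m) mulr_sumr; apply: eq_bigr => j _.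
by rewrite -exprM mulrCA -exprS addn1.
Qed.

(** The coefficients of [P] are polynomials acting through [xdd]; size at most n means that only
    d_1, d_3, ..., d_(2n-1) occur. *)
Lemma spanned_dpoly (P : {poly {mpoly C[n]}}) w : (size P <= n)%N -> spanned w -> spanned (dpoly P w).
Proof.
move=> le_n Hw; have -> : dpoly P w = \sum_(j < n) xdd P`_j (dop (2 * j + 1) w).
  rewrite /dpoly; under eq_bigr => i _ do rewrite (horner_odd _ le_n) xdd_suml raddf_sum.
  rewrite exchange_big; apply: eq_bigr => j _; rewrite dopE raddf_sum.
  by apply: eq_bigr => i _ /=; rewrite xddM Rmul_xdd.
by apply: spanned_sum => j _; apply: spanned_xdd; apply: spanned_dop.
Qed.

Lemma dpolyE (P : {poly {mpoly C[n]}}) w K : dpoly P w K = \sum_(i in K)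
  (-1) ^+ #|[set t in K | (i < t)%N]| * dd ('X_i * P.['X_i ^+ 2]) (w (K :\ i)).
Proof.
rewrite /dpoly sum_ffunE [RHS]big_mkcond; apply: eq_bigr => i _.
by rewrite !ffunE.
Qed.

Lemma odot_omega k w : odot (omega n C k) w = \sum_i xdd ('X_i ^+ k) (thetaD i w).
Proof.
rewrite /omega odot_suml; apply: eq_bigr => i _; rewrite odotE (bigD1 [set i]) //=.
rewrite big1 => [|S /negPf neS]; last by rewrite !ffunE neS mulr0 xdd0l.
by rewrite addr0 !ffunE eqxx mulr1 thetaDs1.
Qed.

Lemma killed_contract k w : odd k -> killed w ->
  \sum_i xdd ('X_i ^+ k) (thetaD i w) = 0.
Proof.
move=> kodd Hw; rewrite -odot_omega; apply: Hw => [pi|]; first exact: act_omega.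
rewrite /const_term /omega sum_ffunE raddf_sum big1 // => i _ /=.
by rewrite !ffunE eq_sym -cards_eq0 cards1 mulr0 mcoeff0.
Qed.

Lemma killed_contract_poly (P : {poly {mpoly C[n]}}) w : killed w ->
  \sum_i xdd ('X_i * P.['X_i ^+ 2]) (thetaD i w) = 0.
Proof.
move=> Hw; under eq_bigr => i _ do rewrite (horner_odd _ (leqnn _)) xdd_suml.
rewrite exchange_big big1 // => j _; under eq_bigr => i _ do rewrite xddM.
by rewrite -raddf_sum killed_contract ?raddf0 // addn1 /= mul2n odd_double.
Qed.

Lemma killed_ann w S : killed w -> ann (es C setT n) (w S).
Proof.
move=> Hw a /mapP[k]; rewrite mem_iota add1n ltnS => kn ->.
have : odot (pemb (eT C setT k)) w = 0.
  apply: Hw => [pi|]; first by rewrite act_pemb invariant_eT.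
  by rewrite /const_term ffunE eqxx mcoeff0_eT // cardsT card_ord.
by rewrite odot_pemb => /ffunP/(_ S); rewrite !ffunE.
Qed.

(** The odd polynomial t P(t^2) vanishes at t = x_i for i < s ([polyF]), respectively for i > s
    outside S ([polyG]), and at t = x_s it gives [fF] or [gF]. *)
Definition polyF s : {poly {mpoly C[n]}} :=
  \prod_(i < n | (i < s)%N) (('X_i ^+ 2)%:P - 'X).
Definition polyG S s : {poly {mpoly C[n]}} :=
  \prod_(i < n | (s < i)%N && (i \notin S)) (('X_i ^+ 2)%:P - 'X).

Lemma size_polyF s : (size (polyF s) <= n)%N.
Proof.
have -> : polyF s = (-1) ^+ #|[set i : 'I_n | (i < s)%N]| * charT C [set i : 'I_n | (i < s)%N].
  rewrite /charT -prodrN; apply: eq_big => [i|i _]; first by rewrite inE.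
  by rewrite opprB.
rewrite -signr_odd mulr_sign; set b := odd _.
have -> : size (if b then - charT C [set i : 'I_n | (i < s)%N] else charT C [set i : 'I_n | (i < s)%N]) = #|[set i : 'I_n | (i < s)%N]|.+1.
  by case: b; rewrite ?size_polyN size_charT.
rewrite -[X in (_ <= X)%N](card_ord n) -cardsT proper_card // properE subsetT.
by apply/subsetPn; exists s; rewrite !inE ?ltnn.
Qed.

Lemma hornerCsubX (R : comNzRingType) (c a : R) : (c%:P - 'X).[a] = c - a.
Proof. by rewrite hornerD hornerN hornerC hornerX. Qed.

Lemma mulr_prod_eq0 (R : comNzRingType) (I : finType) (P : pred I) (F : I -> R) (i : I) (a : R) :
  P i -> F i = 0 -> a * \prod_(l | P l) F l = 0.
Proof. by move=> Pi F0; rewrite (bigD1 i) //= F0 mul0r mulr0. Qed.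

Lemma horner_polyF s i : (i <= s)%N ->
  'X_i * (polyF s).['X_i ^+ 2] = if i == s then fF C s else 0.
Proof.
rewrite leq_eqVlt /polyF horner_prod => /orP[/eqP/val_inj ->|lt_is].
  rewrite eqxx; congr (_ * _); apply: eq_bigr => l _.
  exact: hornerCsubX.
rewrite -val_eqE ltn_eqF //.
apply: (mulr_prod_eq0 _ lt_is).
exact: etrans (hornerCsubX _ _) (subrr _).
Qed.

Lemma horner_polyG S s i : 'X_i * (polyG S s).['X_i ^+ 2] =
  if i == s then gF C S s
  else if (s < i)%N && (i \notin S) then 0 else 'X_i * (polyG S s).['X_i ^+ 2].
Proof.
rewrite /polyG horner_prod; case: eqP => [->|_].
  congr (_ * _); apply: eq_bigr => l _.
  exact: hornerCsubX.
case: ifP => // iS.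
apply: (@mulr_prod_eq0 _ _ (fun l : 'I_n => (s < l)%N && (l \notin S)) _ i _ iS).
exact: etrans (hornerCsubX _ _) (subrr _).
Qed.

Definition weight K := (\sum_(i in K) i)%N.

Definition leader S : Omega n C :=
  foldr (fun s => dpoly (polyF s)) (deltaB n C) (enum S).

Lemma leader0 : leader set0 = deltaB n C.
Proof. by rewrite /leader enum_set0. Qed.

Lemma leaderU1 r S : (forall s, s \in S -> (r < s)%N) ->
  leader (r |: S) = dpoly (polyF r) (leader S).
Proof. by move=> ltrS; rewrite /leader enum_setU1_min. Qed.

Lemma spanned_leader S : spanned (leader S).
Proof.
elim/set_min_ind: S => [|S r ltrS IH].
  by rewrite leader0 -[deltaB n C]dI0; apply: spanned_dI.
by rewrite leaderU1 //; apply: spanned_dpoly => //; apply: size_polyF.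
Qed.

Lemma weightD1 i K : i \in K -> weight K = (i + weight (K :\ i))%N.
Proof. by move=> iK; rewrite /weight (big_setD1 i iK). Qed.

(** The operator of [polyF r] has no θ_i term with i < r. So each r in S contributes an index at
    least r, and weight S is attained only if every contributed index equals r. *)
Lemma leader_supp S K : leader S K != 0 -> (weight S < weight K)%N \/ K = S.
Proof.
elim/set_min_ind: S K => [|S r ltrS IH] K.
  by rewrite leader0 ffunE; case: (K =P set0) => [->|_]; [right | rewrite eqxx].
have rS : r \notin S by apply/negP => /ltrS; rewrite ltnn.
rewrite leaderU1 // dpolyE => nz.
have [i /and3P[iK le_ri nzi]] :
    exists i, [&& i \in K, (r <= i)%N & leader S (K :\ i) != 0].
  apply/existsP; apply: contraNT nz; rewrite negb_exists => /forallP H.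
  rewrite big1 // => i iK; have := H i; rewrite iK /= negb_and negbK.
  rewrite -ltnNge => /orP[lt_ir|/eqP ->]; last by rewrite raddf0 mulr0.
  by rewrite horner_polyF ?(ltnW lt_ir) // -val_eqE ltn_eqF // dd0l mulr0.
rewrite (weightD1 iK) (weightD1 (setU11 r S)) setU1K //.
case: (IH _ nzi) => [ltw|E]; first by left; lia.
rewrite E; move: le_ri; rewrite leq_eqVlt => /orP[/eqP/val_inj ->|lt_ri].
  by right; rewrite -E setD1K.
by left; lia.
Qed.

(** Removing any i other than r from [r |: S] leaves a position lighter than S, where [leader S]
    vanishes; only i = r contributes. *)
Lemma leader_diag S : exists e,
  leader S S = (-1) ^+ e * dd (\prod_(s in S) fF C s) (delta n C).
Proof.
elim/set_min_ind: S => [|S r ltrS [e IH]].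
  by exists 0%N; rewrite leader0 ffunE eqxx big_set0 dd1 mul1r.
have rS : r \notin S by apply/negP => /ltrS; rewrite ltnn.
rewrite leaderU1 // dpolyE (bigD1 r) ?setU11 //= horner_polyF // eqxx setU1K //.
rewrite big1 ?addr0 => [|i /andP[iS neq_ir]]; last first.
  rewrite (_ : leader S _ = 0) ?raddf0 ?mulr0 //; apply/eqP/negPn/negP.
  case/leader_supp => [|E].
    have := weightD1 iS; rewrite (weightD1 (setU11 r S)) setU1K //.
    have : (r < i)%N by move: iS neq_ir; rewrite !inE => /predU1P[->|/ltrS]; rewrite ?eqxx.
    by move=> lt_ri E; rewrite -(ltn_add2l i) -E ltn_add2r ltnNge (ltnW lt_ri).
  by move: rS; rewrite -E !inE eqxx eq_sym neq_ir.
exists (#|[set t in r |: S | (r < t)%N]| + e)%N.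
by rewrite IH dd_sign mulrA -exprD big_setU1 //= -ddM.
Qed.

(** Read the contraction at position [S :\ s]. The indices i > s outside S are roots of [polyG],
    those i < s outside S lead to lighter positions where [w] vanishes, those in [S :\ s] give zero,
    and i = s gives the claim. *)
Lemma killed_gF w S s : killed w -> s \in S ->
  (forall K, (weight K < weight S)%N -> w K = 0) -> dd (gF C S s) (w S) = 0.
Proof.
move=> Hw sS w0; have := killed_contract_poly (polyG S s) Hw.
move/ffunP/(_ (S :\ s)); rewrite sum_ffunE (bigD1 s) //= !ffunE big1 => [|i neq_is].
  rewrite horner_polyG eqxx !inE eqxx /= setD1K // dd_sign addr0 => /eqP.
  by rewrite mulf_eq0 signr_eq0 => /eqP.
rewrite !ffunE horner_polyG (negPf neq_is) !inE neq_is /=.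
case iS: (i \in S); first by rewrite raddf0.
rewrite andbT; case: ltngtP => [_|lt_is|/val_inj E]; first by rewrite dd0l.
  rewrite w0 ?mulr0 ?raddf0 // (weightD1 (setU11 i _)) (weightD1 sS).
  by rewrite setU1K ?ltn_add2r // !inE iS andbF.
by rewrite E eqxx in neq_is.
Qed.

(** All positions of weight N are cleared at once: at that weight the leader of S is nonzero at most
    at S itself, so the corrections do not interfere. *)
Lemma killed_reduce N w : killed w ->
    (forall K, (weight K < N)%N -> w K = 0) ->
  exists2 h, spanned h & forall K, (weight K < N.+1)%N -> (w - h) K = 0.
Proof.
move=> Hw w0.
have /fin_all_exists[a Ha] S : exists a, weight S = N -> w S = dd a (leader S S).
  have [eqN|neqN] := eqVneq (weight S) N; last by exists 0 => /eqP; rewrite (negPf neqN).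
  have [|s sS|a Ea] := @ann_gF_delta n C S (w S); first exact: killed_ann.
    by apply: killed_gF => // K ltK; apply: w0; rewrite -eqN.
  have [e Ee] := leader_diag S; exists ((-1) ^+ e * a) => _.
  by rewrite Ee dd_sign dd_signl mulrA -expr2 sqrr_sign mul1r.
exists (\sum_(S | weight S == N) xdd (a S) (leader S)).
  by apply: spanned_sum => S _; apply/spanned_xdd/spanned_leader.
move=> K; rewrite ltnS leq_eqVlt !ffunE sum_ffunE => /predU1P[eqN|ltN].
  rewrite (bigD1 K) ?eqN //= ffunE -Ha // big1 ?addr0 ?subrr // => S /andP[/eqP eqS neq].
  rewrite ffunE (_ : leader S K = 0) ?raddf0 //; apply/eqP/negPn/negP.
  by case/leader_supp => [|E]; [rewrite eqN eqS ltnn | rewrite E eqxx in neq].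
rewrite w0 // big1 ?subr0 // => S /eqP eqS.
rewrite ffunE (_ : leader S K = 0) ?raddf0 //; apply/eqP/negPn/negP.
by case/leader_supp => [|E]; [rewrite eqS ltnNge ltnW | rewrite -eqS E ltnn in ltN].
Qed.

Lemma killed_spanned w : killed w -> spanned w.
Proof.
move=> Hw; have red N : exists2 h, spanned h & forall K, (weight K < N)%N -> (w - h) K = 0.
  elim: N => [|N [h Hh w0]]; first by exists 0; first exact: spanned0.
  have [|h' Hh' w0'] := @killed_reduce N (w - h) _ w0.
    by apply: killedB => //; apply: spanned_killed.
  exists (h + h'); first exact: spannedD.
  by move=> K ltK; rewrite opprD addrA w0'.
(* The full set has the largest weight, so every coefficient has been cleared. *)
have [h Hh w0] := red (weight [set: 'I_n]).+1.
suff -> : w = h by [].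
apply/eqP; rewrite -subr_eq0; apply/eqP/ffunP => K; rewrite w0 ?ffunE // ltnS.
by rewrite /weight [X in (_ <= X)%N](big_setID K) /= setTI leq_addr.
Qed.

End Span.

Theorem mainTheorem10 (C : numClosedFieldType) (n : nat) (g : Omega n C) :
  SH g <->
  exists p : {set 'I_n} -> {mpoly C[n]},
    g = \sum_(I : {set 'I_n}) odot (pemb (p I)) (dI I (deltaB n C)).
Proof.
rewrite SHP; split; [exact: killed_spanned | exact: spanned_killed].
Qed.
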